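(* Let $R$ be a commutative ring. If the polynomial ring $R[X]$ in one indeterminate $X$ over $R$ is coherent, then $$\mathrm{G\text{-}wdim}(R[X])=\mathrm{G\text{-}wdim}(R)+1.$$
   Context: All rings are commutative with identity element and all modules are unital. A ring is coherent if every finitely generated ideal is finitely presented. An $R$-module $M$ is Gorenstein flat if there is an exact sequence of flat $R$-modules $\mathbf{F}=\cdots\to F_1\to F_0\to F^0\to F^1\to\cdots$ such that $M\cong \mathrm{Im}(F_0\to F^0)$ and such that $-\otimes_R I$ leaves $\mathbf{F}$ exact for every injective $R$-module $I$. The Gorenstein flat dimension $\mathrm{Gfd}_R(M)$ of an $R$-module $M$ is the least integer $k\geq 0$ such that there is an exact sequence $0\to G_k\to\cdots\to G_0\to M\to 0$ with all $G_i$ Gorenstein flat, and $\infty$ if no such $k$ exists. The Gorenstein weak dimension of $R$ is $\mathrm{G\text{-}wdim}(R)=\sup\{\mathrm{Gfd}_R(M)\mid M \text{ an } R\text{-module}\}$, which may be $\infty$ (with $\infty+1=\infty$). *)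

(* Defs.v *)
From HB Require Import structures.
From mathcomp Require Import all_boot all_algebra.
From mathcomp Require Import boolp freeg.

Set Implicit Arguments.
Unset Strict Implicit.
Unset Printing Implicit Defensive.

Import GRing.Theory.
Local Open Scope ring_scope.
Local Open Scope quotient_scope.

Definition exact_at (R : comNzRingType) (A B C : lmodType R)
    (f : A -> B) (g : B -> C) : Prop :=
  forall y : B, g y = 0 <-> exists x : A, f x = y.

Definition surj (A B : Type) (f : A -> B) : Prop :=
  forall y : B, exists x : A, f x = y.

Section SpanQuotient.
Variables (R : comNzRingType) (V : lmodType R) (G : V -> Prop).

Inductive span : V -> Prop :=
| span0 : span 0
| span_lin (a : R) (u v : V) : G u -> span v -> span (a *: u + v).

Lemma span_gen u : G u -> span u.
Proof. by move=> Gu; have := span_lin 1 Gu span0; rewrite scale1r addr0. Qed.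

Lemma spanD u v : span u -> span v -> span (u + v).
Proof.
elim=> [|a w z Gw _ IH] sv; first by rewrite add0r.
by rewrite -addrA; apply: span_lin => //; apply: IH.
Qed.

Lemma spanZ b u : span u -> span (b *: u).
Proof.
elim=> [|a w z Gw _ IH]; first by rewrite scaler0; exact: span0.
by rewrite scalerDr scalerA; apply: span_lin.
Qed.

Definition span_pred : {pred V} := fun x => `[< span x >].

Lemma span_predP x : reflect (span x) (x \in span_pred).
Proof. exact: asboolP. Qed.

Lemma span_pred_zmod_closed : zmod_closed span_pred.
Proof.
split=> [|x y /span_predP sx /span_predP sy]; apply/span_predP.
  exact: span0.
by apply: spanD => //; rewrite -scaleN1r; exact: spanZ.
Qed.

HB.instance Definition _ := GRing.isZmodClosed.Build V span_pred
  span_pred_zmod_closed.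

Definition qspan : Type := Quotient.quot span_pred.

HB.instance Definition _ := GRing.Zmodule.on qspan.

Definition qproj (x : V) : qspan := \pi_(Quotient.quot span_pred) x.

Lemma qproj_eq x y : qproj x = qproj y <-> span (x - y).
Proof.
rewrite /qproj; split.
  by move=> /eqP; rewrite -Quotient.idealrBE => /span_predP.
by move=> s; apply/eqP; rewrite -Quotient.idealrBE; apply/span_predP.
Qed.

Definition qrepr (x : qspan) : V := repr (x : Quotient.quot span_pred).

Lemma qreprK x : qproj (qrepr x) = x.
Proof. exact: reprK. Qed.

Lemma qprojD x y : qproj (x + y) = qproj x + qproj y.
Proof. exact: (@Quotient.pi_add V span_pred). Qed.

Definition qscale (a : R) (x : qspan) : qspan := qproj (a *: qrepr x).

Lemma qprojZ a x : qproj (a *: x) = qscale a (qproj x).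
Proof.
apply/qproj_eq; rewrite -scalerBr; apply: spanZ.
by apply/qproj_eq; rewrite qreprK.
Qed.

Lemma qscaleA a b x : qscale a (qscale b x) = qscale (a * b) x.
Proof. by rewrite -[x]qreprK -!qprojZ scalerA. Qed.

Lemma qscale1 : left_id 1 qscale.
Proof. by move=> x; rewrite -[x]qreprK -!qprojZ scale1r. Qed.

Lemma qscaleDr : right_distributive qscale +%R.
Proof.
by move=> a x y; rewrite -[x]qreprK -[y]qreprK -!(qprojZ, qprojD) scalerDr.
Qed.

Lemma qscaleDl x : {morph qscale^~ x : a b / a + b}.
Proof. by move=> a b; rewrite -[x]qreprK -!(qprojZ, qprojD) scalerDl. Qed.

HB.instance Definition _ := GRing.Zmodule_isLmodule.Build R qspan
  qscaleA qscale1 qscaleDr qscaleDl.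

Lemma qproj_linear : linear qproj.
Proof. by move=> a x y; rewrite qprojD qprojZ. Qed.

HB.instance Definition _ := GRing.isLinear.Build R V qspan *:%R qproj
  qproj_linear.

End SpanQuotient.

Section Tensor.
Variables (R : comNzRingType) (M N : lmodType R).

Notation F := {freeg (M * N)%type / R}.
Notation gen m n := ([freeg [:: (1 : R, (m : M, n : N))]] : F).

Inductive bilinear_rel : F -> Prop :=
| bilinear_relDl (m m' : M) (n : N) :
    bilinear_rel (gen (m + m') n - (gen m n + gen m' n))
| bilinear_relDr (m : M) (n n' : N) :
    bilinear_rel (gen m (n + n') - (gen m n + gen m n'))
| bilinear_relZl (a : R) (m : M) (n : N) :
    bilinear_rel (gen (a *: m) n - a *: gen m n)
| bilinear_relZr (a : R) (m : M) (n : N) :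
    bilinear_rel (gen m (a *: n) - a *: gen m n).

Definition tensor : lmodType R := qspan bilinear_rel.

Definition tens (m : M) (n : N) : tensor := qproj bilinear_rel (gen m n).

Lemma tensDl m m' n : tens (m + m') n = tens m n + tens m' n.
Proof.
rewrite /tens -linearD; apply/qproj_eq/span_gen; exact: bilinear_relDl.
Qed.

Lemma tensDr m n n' : tens m (n + n') = tens m n + tens m n'.
Proof.
rewrite /tens -linearD; apply/qproj_eq/span_gen; exact: bilinear_relDr.
Qed.

Lemma tensZl a m n : tens (a *: m) n = a *: tens m n.
Proof.
rewrite /tens -linearZ; apply/qproj_eq/span_gen; exact: bilinear_relZl.
Qed.

Lemma tensZr a m n : tens m (a *: n) = a *: tens m n.
Proof.
rewrite /tens -linearZ; apply/qproj_eq/span_gen; exact: bilinear_relZr.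
Qed.

Lemma tens_spanP (t : tensor) : exists s : seq (M * N),
  t = \sum_(p <- s) tens p.1 p.2.
Proof.
rewrite -[t]qreprK -[qrepr t]freeg_sumE linear_sum /=.
exists [seq (coeff z (qrepr t) *: z.1, z.2) | z <- dom (qrepr t)].
rewrite [RHS]big_map; apply: eq_bigr => -[m n] _ /=.
rewrite tensZl /tens -linearZ /=; congr (qproj _ _).
by apply/eqP/freeg_eqP => x; rewrite coeffZ !coeffU mul1r.
Qed.

Section Lift.
Variables (P : lmodType R) (b : M -> N -> P).
Hypothesis bDl : forall m m' n, b (m + m') n = b m n + b m' n.
Hypothesis bDr : forall m n n', b m (n + n') = b m n + b m n'.
Hypothesis bZl : forall a m n, b (a *: m) n = a *: b m n.
Hypothesis bZr : forall a m n, b m (a *: n) = a *: b m n.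

Lemma tens_lift_exists :
  exists f : {linear tensor -> P}, forall m n, f (tens m n) = b m n.
Proof.
pose h : F -> P := fglift (fun p => b p.1 p.2).
have hU k m n : h [freeg [:: (k, (m, n))]] = k *: b m n by exact: liftU.
have hB : zmod_morphism h by exact: lift_is_additive.
have h0 : h 0 = 0 by rewrite -(subrr 0) hB subrr.
have hN x : h (- x) = - h x by rewrite -[- x]add0r hB h0 sub0r.
have hD x y : h (x + y) = h x + h y by rewrite -[y in LHS]opprK hB hN opprK.
have hS s (g : M * N -> F) :
    h (\sum_(z <- s) g z) = \sum_(z <- s) h (g z).
  by elim: s => [|z s IH]; rewrite ?big_nil ?big_cons ?hD ?IH.
have hZ a x : h (a *: x) = a *: h x.
  rewrite -[x]freeg_sumE scaler_sumr !hS scaler_sumr.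
  apply: eq_bigr => -[m n] _.
  have -> (k : R) : a *: ([freeg [:: (k, (m, n))]] : F) =
      [freeg [:: (a * k, (m, n))]].
    by apply/eqP/freeg_eqP => y; rewrite coeffZ !coeffU mulrA.
  by rewrite !hU scalerA.
have hrel x : span bilinear_rel x -> h x = 0.
  elim=> // a u v ru _ hv; rewrite hD hZ hv addr0.
  suff -> : h u = 0 by rewrite scaler0.
  by case: ru => *; rewrite hB ?hD ?hZ !hU !scale1r
    ?bDl ?bDr ?bZl ?bZr subrr.
have hq x y : qproj bilinear_rel x = qproj bilinear_rel y -> h x = h y.
  by move=> /qproj_eq /hrel; rewrite hB => /eqP; rewrite subr_eq0 => /eqP.
pose f (t : tensor) : P := h (qrepr t).
have flin : linear f.
  move=> a x y; rewrite /f -hZ -hD; apply: hq.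
  by rewrite qproj_linear !qreprK.
pose fL := GRing.isLinear.Build R tensor P *:%R f flin.
exists (HB.pack_for {linear tensor -> P} f fL) => m n /=.
by rewrite /f -[RHS]scale1r -hU; apply: hq; rewrite qreprK.
Qed.

End Lift.
End Tensor.

Section TensorMap.
Variables (R : comNzRingType) (A B N : lmodType R) (f : {linear A -> B}).

Lemma tensor_map_exists : exists g : {linear tensor A N -> tensor B N},
  forall a n, g (tens a n) = tens (f a) n.
Proof.
apply: (@tens_lift_exists R A N _ (fun a n => tens (f a) n)) => *.
- by rewrite linearD tensDl.
- exact: tensDr.
- by rewrite linearZ tensZl.
- exact: tensZr.
Qed.

(** Chosen classically, but unique by [tensor_map_uniq]. *)
Definition tensor_map : {linear tensor A N -> tensor B N} :=
  projT1 (cid tensor_map_exists).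

Lemma tensor_mapE a n : tensor_map (tens a n) = tens (f a) n.
Proof. by rewrite /tensor_map; case: cid. Qed.

Lemma tensor_map_uniq (g : {linear tensor A N -> tensor B N}) :
  (forall a n, g (tens a n) = tens (f a) n) -> g =1 tensor_map.
Proof.
move=> gE t; have [s ->] := tens_spanP t; rewrite !linear_sum.
by apply: eq_bigr => p _; rewrite /= gE tensor_mapE.
Qed.

End TensorMap.

Definition flat (R : comNzRingType) (M : lmodType R) : Prop :=
  forall (A B C : lmodType R) (f : {linear A -> B}) (g : {linear B -> C}),
    exact_at f g -> exact_at (tensor_map M f) (tensor_map M g).

Definition injective_module (R : comNzRingType) (E : lmodType R) : Prop :=
  forall (A B : lmodType R) (i : {linear A -> B}) (f : {linear A -> E}),
    injective i -> exists g : {linear B -> E}, forall x : A, g (i x) = f x.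

(** A sequence [... -> F_1 -> F_0 -> F^0 -> F^1 -> ...], where [lower F n] is
    [F_n] and [upper F n] is [F^n]. *)
Record two_sided (R : comNzRingType) := TwoSided {
  lower : nat -> lmodType R;
  upper : nat -> lmodType R;
  dlower : forall n, {linear lower n.+1 -> lower n};
  dmid : {linear lower 0%N -> upper 0%N};
  dupper : forall n, {linear upper n -> upper n.+1}
}.

Definition two_sided_exact (R : comNzRingType) (F : two_sided R) : Prop :=
  [/\ forall n, exact_at (dlower F n.+1) (dlower F n),
      exact_at (dlower F 0%N) (dmid F),
      exact_at (dmid F) (dupper F 0%N)
    & forall n, exact_at (dupper F n) (dupper F n.+1)].

Definition two_sided_tensor (R : comNzRingType) (F : two_sided R)
    (N : lmodType R) : two_sided R :=
  @TwoSided R (fun n => tensor (lower F n) N) (fun n => tensor (upper F n) N)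
    (fun n => tensor_map N (dlower F n)) (tensor_map N (dmid F))
    (fun n => tensor_map N (dupper F n)).

(** [i] below, corestricted to the image of [dmid F], is the isomorphism between
    [M] and [Im (F_0 -> F^0)]. *)
Definition gorenstein_flat (R : comNzRingType) (M : lmodType R) : Prop :=
  exists F : two_sided R,
    [/\ (forall n, flat (lower F n)) /\ (forall n, flat (upper F n)),
        two_sided_exact F,
        exists i : {linear M -> upper F 0%N}, injective i /\
          forall y, (exists x, i x = y) <-> (exists z, dmid F z = y)
      & forall I : lmodType R, injective_module I ->
          two_sided_exact (two_sided_tensor F I)].

(** Dimensions live in [option nat], where [None] is the infinite value. *)
Definition enat_le (x y : option nat) : Prop :=
  match x, y with
  | _, None => True
  | None, Some _ => False
  | Some m, Some n => (m <= n)%N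
  end.

Definition enat_succ (x : option nat) : option nat := omap succn x.

Definition least (P : nat -> Prop) : option nat :=
  if pselect (exists n, `[< P n >]) is left exP then Some (ex_minn exP)
  else None.

Definition enat_sup (T : Type) (f : T -> option nat) : option nat :=
  least (fun k => forall t, enat_le (f t) (Some k)).

(** The finite exact sequence [0 -> G_k -> ... -> G_0 -> M -> 0] is continued by
    zero modules [G_n], [n > k]. *)
Definition gflat_resolution (R : comNzRingType) (M : lmodType R) (k : nat)
    : Prop :=
  exists (G : nat -> lmodType R) (d : forall n, {linear G n.+1 -> G n})
         (e : {linear G 0%N -> M}),
    [/\ forall n, (n <= k)%N -> gorenstein_flat (G n),
        forall n, (k < n)%N -> forall x : G n, x = 0,
        forall n, exact_at (d n.+1) (d n),
        exact_at (d 0%N) e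
      & surj e].

Definition Gfd (R : comNzRingType) (M : lmodType R) : option nat :=
  least (gflat_resolution M).

Definition Gwdim (R : comNzRingType) : option nat :=
  enat_sup (fun M : lmodType R => Gfd M).

Definition fg_ideal (R : comNzRingType) (I : R -> Prop) : Prop :=
  exists (n : nat) (a : 'I_n -> R),
    forall x, I x <-> exists c : 'I_n -> R, x = \sum_(i < n) c i * a i.

(** [I] is the image of [p], so this is an exact sequence
    [R^m -> R^n -> I -> 0]. *)
Definition fp_ideal (R : comNzRingType) (I : R -> Prop) : Prop :=
  exists (m n : nat) (r : {linear 'rV[R]_m -> 'rV[R]_n})
         (p : {linear 'rV[R]_n -> R^o}),
    exact_at r p /\ forall x, I x <-> exists u, p u = x.

Definition coherent (R : comNzRingType) : Prop :=
  forall I : R -> Prop, fg_ideal I -> fp_ideal I.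

(* Main.v *)
(** Let [fd] denote flat dimension. Over any commutative ring, [Gwdim R <= n]
    holds iff every injective module [I] has [fd I <= n]. If all modules have
    Gorenstein flat resolutions of length [n], dimension shifting kills
    [Tor_(n+1)(-, I)], since [Tor_i(G, I) = 0] for [G] Gorenstein flat and
    [i > 0]. Conversely, an [n]-th syzygy of [M] embeds, by the horseshoe lemma
    applied to [0 -> M -> E -> M' -> 0] with [E] injective, into an [n]-th syzygy
    of [E], which is flat, with cokernel an [n]-th syzygy of [M']; iterating
    yields a complete flat resolution.

    It remains to compare injectives over [R] and [R[X]]. An injective
    [R[X]]-module [E] is injective over [R], and
    [0 -> E[X] -> E[X] -> E -> 0] gives [fd_R[X] E <= fd_R E + 1]. For [I]
    injective over [R], the module [Hom_R(R[X], I)] is injective over [R[X]] and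
    multiplication by [X] on it is onto with kernel [I], on which [X] is zero;
    so [fd_R[X] I <= n + 1], and this forces [fd_R I <= n] because
    [Tor^R[X]_(i+1)(I, N)] contains [Tor^R_i(I, N)] when [X] kills [I] and [N].

    [Tor] is never constructed: [M (x) N] is replaced by its group of characters,
    the balanced biadditive maps from [M] and [N] to [Q/Z]. *)

From HB Require Import structures.
From mathcomp Require Import all_boot all_order all_algebra.
From mathcomp Require Import boolp classical_sets functions.
Require Import Defs.

Set Implicit Arguments.
Unset Strict Implicit.
Unset Printing Implicit Defensive.

Import Order.TTheory GRing.Theory Num.Theory.
Local Open Scope classical_set_scope.
Local Open Scope ring_scope.

(** * Characters of abelian groups *)

Definition subgroup (B : zmodType) (S : B -> Prop) : Prop :=
  S 0 /\ forall x y, S x -> S y -> S (x - y).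

Section Subgroup.
Variables (B : zmodType) (S : B -> Prop) (hS : subgroup S).

Lemma subgroupN x : S x -> S (- x).
Proof. by move=> Sx; rewrite -sub0r; apply: hS.2 => //; exact: hS.1. Qed.

Lemma subgroupD x y : S x -> S y -> S (x + y).
Proof. by move=> Sx Sy; rewrite -[y]opprK; apply: hS.2 => //; exact: subgroupN. Qed.

Lemma subgroupMz x (k : int) : S x -> S (x *~ k).
Proof.
move=> Sx; have Sn n : S (x *+ n).
  elim: n => [|n IH]; first by rewrite mulr0n; exact: hS.1.
  by rewrite mulrS; exact: subgroupD.
by case: k => n; [exact: Sn | exact/subgroupN/Sn].
Qed.

(** The integers carrying [x] into [S] form an ideal; Euclidean division by its least positive
    element leaves a remainder that minimality forces to be zero. *)
Lemma subgroup_order x :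
  (forall k : int, S (x *~ k) -> k = 0) \/
  exists m : nat, [/\ (0 < m)%N, S (x *+ m) &
    forall k : int, S (x *~ k) -> exists q : int, k = q * m%:Z].
Proof.
have [hex|hnex] := pselect (exists m, `[< (0 < m)%N /\ S (x *+ m) >]); last first.
  left=> k Sk; apply: contrapT => k0; apply: hnex; exists `|k|%N; apply/asboolP.
  split; first by rewrite absz_gt0; apply/eqP.
  case: k Sk {k0} => n // /subgroupN; rewrite NegzE.
  by rewrite mulrNz opprK abszN.
right; exists (ex_minn hex); case: ex_minnP => m /asboolP[m0 Sm] mmin; split=> // k Sk.
exists (k %/ m%:Z)%Z; have Er := divz_eq k m%:Z.
have m0' : m%:Z != 0 by rewrite eqz_nat -lt0n.
have := modz_ge0 k m0'; have := ltz_pmod k (m0 : 0 < m%:Z).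
move: Er; case: (modz k m%:Z) => // r Er rm _.
have : S (x *+ r).
  have -> : x *+ r = x *~ k - (x *+ m) *~ (k %/ m%:Z)%Z.
    rewrite {1}Er mulrzDr -[x *+ m]/(x *~ m%:Z) -mulrzA [m%:Z * _]mulrC.
    by rewrite addrAC addrN add0r.
  by apply: hS.2 => //; exact: subgroupMz.
move=> Sr; case: r Er rm Sr => [|r] Er rm Sr; first by rewrite {1}Er addr0.
have : (m <= r.+1)%N by apply: mmin; apply/asboolP.
by rewrite leqNgt; rewrite ltz_nat in rm; rewrite rm.
Qed.

End Subgroup.

Section QmodZ.

Let isone (x : zmodule rat) : Prop := x = 1 :> rat.

Lemma span_isone (x : zmodule rat) : span isone x -> exists k : int, x = k%:~R :> rat.
Proof.
elim=> [|a u v -> _ [k ->]]; first by exists 0.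
by exists (a + k); rewrite rmorphD.
Qed.

Lemma divisible_cogenerator : exists T : zmodType,
  (forall n (x : T), (0 < n)%N -> exists y, y *+ n = x) /\
  (forall n, (1 < n)%N -> exists2 t : T, t <> 0 & t *+ n = 0).
Proof.
have pM (x : zmodule rat) n : qproj isone x *+ n = qproj isone (x *+ n).
  by elim: n => [|n IH]; rewrite ?mulr0n ?linear0 // !mulrS IH linearD.
exists (qspan isone); split=> [n x n0|n n1].
  exists (qproj isone ((qrepr x : rat) / n%:R : rat)).
  rewrite pM -[RHS]qreprK; congr (qproj _ _).
  have E (a : rat) : (a / n%:R) *+ n = a.
    by rewrite -[LHS]mulr_natr divfK // pnatr_eq0 -lt0n.
  exact: E.
have n0 : (n%:R : rat) != 0 by rewrite pnatr_eq0 -lt0n ltnW.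
exists (qproj isone (n%:R^-1 : rat)) => [|]; last first.
  rewrite pM -(linear0 (qproj isone)); apply/qproj_eq; rewrite subr0.
  apply: span_gen; have E : (n%:R^-1 : rat) *+ n = 1 by rewrite -[LHS]mulr_natr mulVf.
  exact: E.
rewrite -(linear0 (qproj isone)) => /qproj_eq; rewrite subr0 => /span_isone[k].
move=> /(congr1 (fun x => x * n%:R)); rewrite mulVf // => /eqP.
rewrite -[n%:R]/(n%:~R) -intrM -[1]/(1%:~R) eqr_int => /eqP /(congr1 absz).
rewrite abszM /= => /esym /eqP; rewrite muln_eq1 => /andP[_ /eqP nE].
by rewrite nE in n1.
Qed.

End QmodZ.

(** [Q/Z]; only divisibility and the existence of torsion elements of
    every order are used. *)
Definition QZ : zmodType := projT1 (cid divisible_cogenerator).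

Lemma QZ_divisible n (x : QZ) : (0 < n)%N -> exists y, y *+ n = x.
Proof. exact: (projT2 (cid divisible_cogenerator)).1. Qed.

Lemma QZ_torsion n : (1 < n)%N -> exists2 t : QZ, t <> 0 & t *+ n = 0.
Proof. exact: (projT2 (cid divisible_cogenerator)).2. Qed.

Section Extension.
Variable B : zmodType.
Implicit Types G H : set (B * QZ).

(** The graph of a homomorphism from a subgroup of [B] to [QZ]: for a subgroup, single-valuedness
    need only be asked over 0. Inclusion of graphs is the order for Zorn's lemma. *)
Definition pgraph H : Prop := subgroup H /\ forall t, H (0, t) -> t = 0.

(** If some positive multiple of [x] lies in the domain, the least one gives the equation for the
    value at [x], and divisibility of [QZ] solves it; otherwise the value 0 is taken. *)
Lemma pgraph_extend1 H (x : B) : pgraph H ->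
  exists H', [/\ pgraph H', H `<=` H' & exists t, H' (x, t)].
Proof.
move=> [sH fH].
have pMz (y : B) (u : QZ) (k : int) : (y, u) *~ k = (y *~ k, u *~ k).
  have pMn n : (y, u) *+ n = (y *+ n, u *+ n).
    by elim: n => // n IH; rewrite !mulrS IH.
  by case: k => n; [exact: pMn | rewrite NegzE !mulrNz -[(y, u) *~ _]/((y, u) *+ n.+1) pMn].
have sD : subgroup (fun y => exists u, H (y, u)).
  split; first by exists 0; exact: sH.1.
  by move=> y z [u Hu] [v Hv]; exists (u - v); exact: (sH.2 _ _ Hu Hv).
have [t tP] : exists t : QZ, forall k v, H (x *~ k, v) -> v = t *~ k.
  case: (subgroup_order sD x) => [h|[m [m0 [s Hs] h]]].
    exists 0 => k v Hv; have k0 : k = 0 by apply: h; exists v.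
    by move: Hv; rewrite k0 !mulr0z; exact: fH.
  have [t tE] := QZ_divisible s m0; exists t => k v Hv.
  have [q kE] : exists q : int, k = q * m%:Z by apply: h; exists v.
  have := subgroupMz sH q Hs; rewrite pMz => Hq.
  have := sH.2 _ _ Hv Hq.
  have -> : (x *~ k, v) - ((x *+ m) *~ q, s *~ q) = (0, v - t *~ k).
    rewrite -[LHS]/(x *~ k - (x *+ m) *~ q, v - s *~ q) kE [q * _]mulrC !mulrzA.
    by rewrite subrr -tE.
  by move=> /fH /eqP; rewrite subr_eq0 => /eqP.
exists (fun z => exists y u k, [/\ H (y, u), z.1 = y + x *~ k & z.2 = u + t *~ k]).
split; [split; [split|]|..].
- by exists 0, 0, 0; rewrite !mulr0z !addr0; split=> //; exact: sH.1.
- move=> [a b] [a' b'] [y [u [k [Hy /= -> ->]]]] [y' [u' [k' [Hy' /= -> ->]]]].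
  exists (y - y'), (u - u'), (k - k'); split; first exact: (sH.2 _ _ Hy Hy').
  + by rewrite mulrzBr opprD addrACA.
  + by rewrite mulrzBr opprD addrACA.
- move=> s [y [u [k [Hy /= /esym/eqP yE ->]]]].
  move: yE; rewrite addr_eq0 -mulrNz => /eqP yE.
  by rewrite yE in Hy; rewrite (tP _ _ Hy) mulrNz addNr.
- by move=> [y u] Hy; exists y, u, 0; rewrite !mulr0z !addr0.
- by exists t, 0, 0, 1; rewrite !add0r; split=> //; exact: sH.1.
Qed.

Lemma pgraph_total G : pgraph G ->
  exists g : B -> QZ, zmod_morphism g /\ forall x t, G (x, t) -> g x = t.
Proof.
move=> pG.
(* The guard makes the union of the empty chain satisfy [P]. *)
pose P H := H !=set0 -> pgraph H /\ G `<=` H.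
have [|H [PH Hmax]] := @Zorn_bigcup _ P.
  move=> F FP Ftot [z0 [H0 FH0 H0z0]].
  have FP' H : F H -> H !=set0 -> pgraph H /\ G `<=` H by move=> /FP.
  have [pH0 GH0] := FP' _ FH0 (ex_intro _ _ H0z0).
  split; last by move=> z Gz; exists H0 => //; exact: GH0.
  split; [split|].
  - by exists H0 => //; exact: pH0.1.1.
  - move=> x y [H1 F1 H1x] [H2 F2 H2y].
    have p1 := (FP' _ F1 (ex_intro _ _ H1x)).1.
    have p2 := (FP' _ F2 (ex_intro _ _ H2y)).1.
    case: (Ftot _ _ F1 F2) => h12.
    + by exists H2 => //; apply: p2.1.2 => //; exact: h12.
    + by exists H1 => //; apply: p1.1.2 => //; exact: h12.
  - by move=> t [H1 F1 H1x]; exact: (FP' _ F1 (ex_intro _ _ H1x)).1.2.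
(* An empty maximal element would be properly contained in [G], which contains (0, 0). *)
have H0 : H !=set0.
  apply: contrapT => /set0P/negP; rewrite negbK => /eqP HE.
  apply: (Hmax G) => [|_]; last by split.
  by rewrite HE; split=> // h; have /= := h (0, 0) pG.1.1.
have [pH GH] := PH H0.
have Htot x : exists t, H (x, t).
  have [H' [pH' HH' [t H't]]] := pgraph_extend1 x pH.
  apply: contrapT => nH; apply: (Hmax H').
    by split=> // h; apply: nH; exists t; exact: h.
  by move=> _; split=> //; exact: subset_trans GH HH'.
pose g x := projT1 (cid (Htot x)).
have gP x : H (x, g x) by rewrite /g; case: cid.
have gE x t : H (x, t) -> g x = t.
  move=> Ht; apply/eqP; rewrite -subr_eq0; apply/eqP/pH.2.
  by have := pH.1.2 _ _ (gP x) Ht; rewrite -[_ - _]/(x - x, g x - t) subrr.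
exists g; split=> [x y|x t /GH]; last exact: gE.
by apply: gE; have := pH.1.2 _ _ (gP x) (gP y).
Qed.

Lemma QZ_extend (A : zmodType) (i : A -> B) (f : A -> QZ) :
  zmod_morphism i -> injective i -> zmod_morphism f ->
  exists g : B -> QZ, zmod_morphism g /\ forall a, g (i a) = f a.
Proof.
move=> iB iI fB.
have [|g [gB gE]] := @pgraph_total (fun z => exists a, z = (i a, f a)).
  have i0 : i 0 = 0 by rewrite -[0 in LHS](subrr 0) iB subrr.
  have f0 : f 0 = 0 by rewrite -[0 in LHS](subrr 0) fB subrr.
  split; [split|].
  - by exists 0; rewrite i0 f0.
  - by move=> _ _ [a ->] [b ->]; exists (a - b); rewrite iB fB.
  - by move=> t [a [aE ->]]; rewrite -[RHS]f0; congr f; apply: iI; rewrite i0 aE.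
by exists g; split=> // a; apply: gE; exists a.
Qed.

(** The character is first prescribed on [S] and [x]: zero on [S], and at [x] a nonzero value killed
    by the order of [x] modulo [S]. *)
Lemma QZ_separate (S : B -> Prop) (x : B) : subgroup S -> ~ S x ->
  exists g : B -> QZ, [/\ zmod_morphism g, forall y, S y -> g y = 0 & g x <> 0].
Proof.
move=> sS nSx.
have [t t0 tP] : exists2 t : QZ, t <> 0 & forall k, S (x *~ k) -> t *~ k = 0.
  case: (subgroup_order sS x) => [h|[m [m0 Sm h]]].
    (* Here [x] has infinite order modulo [S], so any nonzero [t] serves; 2-torsion supplies one. *)
    have [t t0 _] := @QZ_torsion 2 isT.
    by exists t => // k /h ->.
  have m1 : (1 < m)%N.
    by case: m m0 Sm {h} => [|[|m]] // _; rewrite mulr1n.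
  have [t t0 tm] := QZ_torsion m1; exists t => // k /h [q ->].
  by rewrite mulrC mulrzA -pmulrn tm mul0rz.
have [|g [gB gE]] :=
  @pgraph_total (fun z => exists y k, [/\ S y, z.1 = y + x *~ k & z.2 = t *~ k]).
  split; [split|].
  - by exists 0, 0; rewrite !mulr0z addr0; split=> //; exact: sS.1.
  - move=> [a b] [a' b'] [y [k [Sy /= -> ->]]] [y' [k' [Sy' /= -> ->]]].
    exists (y - y'), (k - k'); split; first exact: sS.2.
    + by rewrite mulrzBr opprD addrACA.
    + by rewrite mulrzBr.
  - move=> s [y [k [Sy /= /esym/eqP yE ->]]].
    move: yE; rewrite addrC addr_eq0 => /eqP yE.
    by apply: tP; rewrite yE; exact: subgroupN.
exists g; split=> // [y Sy|].
  by apply: gE; exists y, 0; rewrite !mulr0z addr0.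
by rewrite (gE x t) //; exists 0, 1; rewrite add0r; split=> //; exact: sS.1.
Qed.

End Extension.

(** * Submodules, direct sums and character modules *)

Lemma zmod_morphism0 (A B : zmodType) (f : A -> B) : zmod_morphism f -> f 0 = 0.
Proof. by move=> fB; rewrite -[0 in LHS](subrr 0) fB subrr. Qed.

Lemma zmod_morphismD (A B : zmodType) (f : A -> B) :
  zmod_morphism f -> {morph f : x y / x + y}.
Proof.
by move=> fB x y; rewrite -[y in LHS]opprK -[- y]sub0r !fB (zmod_morphism0 fB) sub0r opprK.
Qed.

Lemma zmod_morphism_sum (A B : zmodType) (f : A -> B) (I : Type) (s : seq I)
    (F : I -> A) :
  zmod_morphism f -> f (\sum_(i <- s) F i) = \sum_(i <- s) f (F i).
Proof.
move=> fB; elim: s => [|i s IH]; first by rewrite !big_nil zmod_morphism0.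
by rewrite !big_cons zmod_morphismD // IH.
Qed.

Section LinearMaps.
Variable R : pzRingType.
Implicit Types A B C V W : lmodType R.

Definition mk_linear A B (f : A -> B) (lf : linear f) : {linear A -> B} :=
  HB.pack_for {linear A -> B} f (GRing.isLinear.Build R A B *:%R f lf).

Lemma mk_linearE A B (f : A -> B) (lf : linear f) : mk_linear lf =1 f.
Proof. by []. Qed.

Lemma factor_inj W V A (i : {linear W -> V}) (f : {linear A -> V}) :
  injective i -> (forall a, exists w, i w = f a) ->
  exists g : {linear A -> W}, forall a, i (g a) = f a.
Proof.
move=> iI hf; pose g a := projT1 (cid (hf a)).
have gE a : i (g a) = f a by rewrite /g; case: cid.
have lg : linear g by move=> r a b; apply: iI; rewrite linearP !gE linearP.
by exists (mk_linear lg).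
Qed.

Lemma factor_surj A B C (p : {linear A -> B}) (f : {linear A -> C}) :
  surj p -> (forall a, p a = 0 -> f a = 0) ->
  exists g : {linear B -> C}, forall a, g (p a) = f a.
Proof.
move=> pS hf; pose s b := projT1 (cid (pS b)).
have sE b : p (s b) = b by rewrite /s; case: cid.
have fE a a' : p a = p a' -> f a = f a'.
  move=> E; apply/eqP; rewrite -subr_eq0 -linearB; apply/eqP/hf.
  by rewrite linearB E subrr.
have lg : linear (f \o s).
  by move=> r a b /=; rewrite -linearP; apply: fE; rewrite linearP !sE.
by exists (mk_linear lg) => a; apply: fE; rewrite sE.
Qed.

End LinearMaps.

Section Submodule.
Variables (R : pzRingType) (V : lmodType R).

Definition submodule (S : V -> Prop) : Prop :=
  S 0 /\ forall a x y, S x -> S y -> S (a *: x + y).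

Variables (S : V -> Prop) (hS : submodule S).

Definition submod_pred of submodule S : {pred V} := fun x => `[< S x >].

Lemma submod_predP x : reflect (S x) (x \in submod_pred hS).
Proof. exact: asboolP. Qed.

Lemma submod_pred_closed : submod_closed (submod_pred hS).
Proof.
split; first exact/submod_predP/hS.1.
by move=> a x y /submod_predP Sx /submod_predP Sy; apply/submod_predP/hS.2.
Qed.

HB.instance Definition _ := GRing.isSubmodClosed.Build R V (submod_pred hS)
  submod_pred_closed.

Definition submod : Type := {x : V | x \in submod_pred hS}.

HB.instance Definition _ := SubType.on submod.
HB.instance Definition _ := Choice.on submod.
HB.instance Definition _ := [SubChoice_isSubLmodule of submod by <:].

Definition submod_inc (x : submod) : V := val x.

Lemma submod_inc_linear : linear submod_inc.
Proof. exact: linearP. Qed.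

HB.instance Definition _ := GRing.isLinear.Build R submod V *:%R submod_inc
  submod_inc_linear.

Lemma submod_inc_inj : injective submod_inc.
Proof. exact: val_inj. Qed.

Lemma submod_incP v : S v <-> exists w, submod_inc w = v.
Proof.
split=> [Sv|[w <-]]; last exact/submod_predP/(valP w).
by exists (exist _ v (introT (submod_predP v) Sv)).
Qed.

Lemma submod_inc_in w : S (submod_inc w).
Proof. by apply/submod_incP; exists w. Qed.

End Submodule.

Section Kernel.
Variables (R : pzRingType) (A B : lmodType R) (f : {linear A -> B}).

Lemma kernel_submodule : submodule (fun x => f x = 0).
Proof.
split; first exact: linear0.
by move=> a x y fx fy; rewrite linearP fx fy scaler0 addr0.
Qed.

Definition kernel : lmodType R := submod kernel_submodule.
Definition kernel_inc : {linear kernel -> A} := @submod_inc _ _ _ kernel_submodule.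

Lemma kernel_inc_inj : injective kernel_inc.
Proof. exact: submod_inc_inj. Qed.

Lemma kernel_incP x : f x = 0 <-> exists w, kernel_inc w = x.
Proof. exact: submod_incP. Qed.

Lemma kernel_incK w : f (kernel_inc w) = 0.
Proof. by apply/kernel_incP; exists w. Qed.

End Kernel.

Section DirectSum.
Variables (R : pzRingType) (X : eqType) (A : lmodType R).

Lemma finsupp_submodule : submodule (fun f : X -> A =>
  exists s : seq X, forall x, x \notin s -> f x = 0).
Proof.
split; first by exists [::].
move=> a f g [s sP] [t tP]; exists (s ++ t) => x; rewrite mem_cat negb_or.
by case/andP=> xs xt; rewrite /= !fctE sP // tP // scaler0 addr0.
Qed.

Definition dsum : lmodType R := submod finsupp_submodule.

Definition dsum_coord (x : X) (p : dsum) : A := submod_inc p x.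

Lemma dsum_coordP x : linear (dsum_coord x).
Proof. by move=> a p q; rewrite /dsum_coord linearP. Qed.

HB.instance Definition _ x := GRing.isLinear.Build R dsum A *:%R
  (dsum_coord x) (dsum_coordP x).

Lemma dsum_eq (p q : dsum) : (forall x, dsum_coord x p = dsum_coord x q) -> p = q.
Proof. by move=> E; apply: submod_inc_inj; apply/funext. Qed.

Lemma dsum_mk (f : X -> A) (s : seq X) : (forall x, x \notin s -> f x = 0) ->
  exists p : dsum, forall x, dsum_coord x p = f x.
Proof.
move=> h; have [|p pE] := (submod_incP finsupp_submodule f).1; first by exists s.
by exists p => x; rewrite /dsum_coord pE.
Qed.

Lemma dsum_delta_exists (x : X) (a : A) :
  exists p : dsum, forall y, dsum_coord y p = if y == x then a else 0.
Proof.
by apply: (@dsum_mk _ [:: x]) => y; rewrite inE; case: eqP.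
Qed.

Definition dsum_delta x a : dsum := projT1 (cid (dsum_delta_exists x a)).

Lemma dsum_deltaE x a y : dsum_coord y (dsum_delta x a) = if y == x then a else 0.
Proof. by rewrite /dsum_delta; case: cid. Qed.

Lemma dsum_delta_linear x : linear (dsum_delta x).
Proof.
move=> r a b; apply: dsum_eq => y; rewrite dsum_deltaE.
rewrite [RHS](linearP (dsum_coord y)) /= !dsum_deltaE.
by case: eqP; rewrite // scaler0 addr0.
Qed.

HB.instance Definition _ x := GRing.isLinear.Build R A dsum *:%R
  (dsum_delta x) (dsum_delta_linear x).

Lemma dsum_suppP (p : dsum) :
  exists s : seq X, uniq s /\ forall x, x \notin s -> dsum_coord x p = 0.
Proof.
have [s sP] := submod_inc_in p; exists (undup s); split; first exact: undup_uniq.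
by move=> x; rewrite mem_undup; exact: sP.
Qed.

(** A chosen duplicate-free list containing the support, possibly with further points. *)
Definition dsum_supp p : seq X := projT1 (cid (dsum_suppP p)).

Lemma dsum_supp_uniq p : uniq (dsum_supp p).
Proof. by rewrite /dsum_supp; case: cid => s []. Qed.

Lemma dsum_suppN p x : x \notin dsum_supp p -> dsum_coord x p = 0.
Proof. by rewrite /dsum_supp; case: cid => s [_ h] /=; exact: h. Qed.

Lemma dsum_sum (p : dsum) :
  p = \sum_(x <- dsum_supp p) dsum_delta x (dsum_coord x p).
Proof.
apply: dsum_eq => y; rewrite (linear_sum (dsum_coord y)) /=.
under eq_bigr do rewrite dsum_deltaE eq_sym.
rewrite -big_mkcond /=; have [ys|ys] := boolP (y \in dsum_supp p).
  rewrite (big_rem _ ys) /= eqxx big1_seq ?addr0 // => x /andP[/eqP ->].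
  by rewrite mem_rem_uniqF // dsum_supp_uniq.
by rewrite dsum_suppN // big1_seq // => x /andP[/eqP -> xs]; rewrite xs in ys.
Qed.

Lemma dsum_ext (Z : zmodType) (f g : dsum -> Z) : zmod_morphism f -> zmod_morphism g ->
  (forall x a, f (dsum_delta x a) = g (dsum_delta x a)) -> f =1 g.
Proof.
move=> fB gB h p; rewrite (dsum_sum p) !zmod_morphism_sum //.
by apply: eq_bigr => x _; exact: h.
Qed.

Section Fold.
Variables (Z : zmodType) (c : X -> A -> Z).
Hypothesis cB : forall x, zmod_morphism (c x).

Definition dsum_fold (p : dsum) : Z :=
  \sum_(x <- dsum_supp p) c x (dsum_coord x p).

(** Two lists covering the support are compared on a common enlargement, where the extra terms
    vanish. *)
Lemma dsum_foldE p (s : seq X) : uniq s ->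
  (forall x, x \notin s -> dsum_coord x p = 0) ->
  dsum_fold p = \sum_(x <- s) c x (dsum_coord x p).
Proof.
move=> us hs; rewrite /dsum_fold.
have widen (t : seq X) : uniq t -> (forall x, x \notin t -> dsum_coord x p = 0) ->
    {subset t <= s ++ dsum_supp p} -> \sum_(x <- t) c x (dsum_coord x p) =
    \sum_(x <- undup (s ++ dsum_supp p)) c x (dsum_coord x p).
  move=> ut ht st.
  rewrite [RHS](bigID (fun x => x \in t)) /= [X in _ + X]big1 ?addr0; last first.
    by move=> x /ht ->; rewrite zmod_morphism0.
  rewrite -[RHS]big_filter; apply: perm_big; apply: uniq_perm => //.
    by rewrite filter_uniq // undup_uniq.
  move=> x; rewrite mem_filter mem_undup; case: (boolP (x \in t)) => //= xt.
  by rewrite st.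
rewrite (widen s us hs) => [|x xs]; last by rewrite mem_cat xs.
apply: widen => [||x xs]; first exact: dsum_supp_uniq.
  by move=> x; exact: dsum_suppN.
by rewrite mem_cat xs orbT.
Qed.

Lemma dsum_fold_zmod_morphism : zmod_morphism dsum_fold.
Proof.
move=> p q; pose s := undup (dsum_supp p ++ dsum_supp q).
have us : uniq s by exact: undup_uniq.
have hs x : x \notin s -> dsum_coord x p = 0 /\ dsum_coord x q = 0.
  rewrite mem_undup mem_cat negb_or => /andP[xp xq].
  by rewrite !dsum_suppN.
have cE x : dsum_coord x (p - q) = dsum_coord x p - dsum_coord x q.
  exact: (linearB (dsum_coord x)).
rewrite (@dsum_foldE p s) //; last by move=> x /hs[].
rewrite (@dsum_foldE q s) //; last by move=> x /hs[].
rewrite (@dsum_foldE (p - q) s) //; last by move=> x /hs[px qx]; rewrite cE px qx subrr.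
by rewrite -sumrB; apply: eq_bigr => x _; rewrite cE cB.
Qed.

Lemma dsum_fold_delta x a : dsum_fold (dsum_delta x a) = c x a.
Proof.
rewrite (@dsum_foldE _ [:: x]) //; first by rewrite big_seq1 dsum_deltaE eqxx.
by move=> y; rewrite inE dsum_deltaE => /negPf ->.
Qed.

End Fold.
End DirectSum.

Section CharacterModule.
Variables (R : comNzRingType) (M : lmodType R).

Definition char_pred : {pred M -> QZ} := fun f => `[< zmod_morphism f >].

Lemma char_predP f : reflect (zmod_morphism f) (f \in char_pred).
Proof. exact: asboolP. Qed.

Lemma char_pred_closed : zmod_closed char_pred.
Proof.
split; first by apply/char_predP => x y; rewrite /= subrr.
move=> f g /char_predP fB /char_predP gB; apply/char_predP => x y.
by rewrite !fctE fB gB !opprD !opprK addrACA.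
Qed.

HB.instance Definition _ := GRing.isZmodClosed.Build (M -> QZ) char_pred
  char_pred_closed.

Definition charmod : Type := {f : M -> QZ | f \in char_pred}.

HB.instance Definition _ := SubType.on charmod.
HB.instance Definition _ := Choice.on charmod.
HB.instance Definition _ := [SubChoice_isSubZmodule of charmod by <:].

Definition char_val (f : charmod) : M -> QZ := val f.

Lemma char_valB f : zmod_morphism (char_val f).
Proof. exact/char_predP/(valP f). Qed.

Definition mk_char (f : M -> QZ) (fB : zmod_morphism f) : charmod :=
  exist _ f (introT (char_predP f) fB).

Lemma mk_charE f (fB : zmod_morphism f) : char_val (mk_char fB) = f.
Proof. by []. Qed.

Lemma char_eq f g : char_val f =1 char_val g -> f = g.
Proof. by move=> h; apply: val_inj; apply/funext. Qed.

Lemma char_sub f g x : char_val (f - g) x = char_val f x - char_val g x.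
Proof. by []. Qed.

Lemma char_add f g x : char_val (f + g) x = char_val f x + char_val g x.
Proof. by []. Qed.

Lemma char_scaleB (r : R) (f : charmod) : zmod_morphism (fun x => char_val f (r *: x)).
Proof. by move=> x y; rewrite scalerBr char_valB. Qed.

Definition char_scale r f : charmod := mk_char (char_scaleB r f).

Lemma char_scaleA a b f : char_scale a (char_scale b f) = char_scale (a * b) f.
Proof. by apply: char_eq => x; rewrite /= !mk_charE scalerA mulrC. Qed.

Lemma char_scale1 : left_id 1 char_scale.
Proof. by move=> f; apply: char_eq => x; rewrite mk_charE scale1r. Qed.

Lemma char_scaleDr : right_distributive char_scale +%R.
Proof. by move=> a f g; apply: char_eq => x; rewrite char_add !mk_charE. Qed.

Lemma char_scaleDl f : {morph char_scale^~ f : a b / a + b}.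
Proof.
move=> a b; apply: char_eq => x; rewrite char_add !mk_charE scalerDl.
by rewrite (zmod_morphismD (@char_valB f)).
Qed.

HB.instance Definition _ := GRing.Zmodule_isLmodule.Build R charmod
  char_scaleA char_scale1 char_scaleDr char_scaleDl.

Lemma char_scaleE (r : R) f x : char_val (r *: f) x = char_val f (r *: x).
Proof. by []. Qed.

End CharacterModule.

(** * Balanced maps and vanishing of Tor_1 *)

Section DsumLift.
Variables (R : pzRingType) (X : eqType) (A W : lmodType R).

Lemma dsum_lift (c : X -> {linear A -> W}) :
  exists f : {linear dsum X A -> W}, forall x a, f (dsum_delta x a) = c x a.
Proof.
have cB x : zmod_morphism (c x) by move=> a b; rewrite linearB.
have fB := dsum_fold_zmod_morphism cB.
have fZ r p : dsum_fold c (r *: p) = r *: dsum_fold c p.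
  apply: (@dsum_ext _ _ _ _ (fun p => dsum_fold c (r *: p))
    (fun p => r *: dsum_fold c p)) => [p1 p2|p1 p2|x a].
  - by rewrite scalerBr fB.
  - by rewrite fB scalerBr.
  - by rewrite -linearZ /= !dsum_fold_delta // linearZ.
have fL : linear (dsum_fold c) by move=> r p q; rewrite (zmod_morphismD fB) fZ.
by exists (mk_linear fL) => x a; rewrite mk_linearE dsum_fold_delta.
Qed.

End DsumLift.

Section Balanced.
Variable R : comNzRingType.
Implicit Types A B C M N Y : lmodType R.

Definition balanced M N (b : M -> N -> QZ) : Prop :=
  [/\ forall n, zmod_morphism (b^~ n), forall m, zmod_morphism (b m)
    & forall r m n, b (r *: m) n = b m (r *: n)].

Lemma balancedC M N (b : M -> N -> QZ) : balanced b -> balanced (fun n m => b m n).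
Proof. by case=> bl br bz; split=> // r m n; rewrite bz. Qed.

Lemma balanced_compl A M N (f : {linear A -> M}) (b : M -> N -> QZ) :
  balanced b -> balanced (fun a n => b (f a) n).
Proof.
by case=> bl br bz; split=> [n x y|a x y|r a n];
  rewrite ?linearB ?linearZ ?bl ?br ?bz.
Qed.

Lemma balanced_compr A M N (f : {linear A -> N}) (b : M -> N -> QZ) :
  balanced b -> balanced (fun m a => b m (f a)).
Proof. by move=> /balancedC/(balanced_compl f)/balancedC. Qed.

Lemma balancedB M N (b c : M -> N -> QZ) : balanced b -> balanced c ->
  balanced (fun m n => b m n - c m n).
Proof.
case=> bl br bz [cl cr cz]; split=> [n x y|m x y|r m n].
- by rewrite bl cl !opprD opprK addrACA.
- by rewrite br cr !opprD opprK addrACA.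
- by rewrite bz cz.
Qed.

Lemma balanced0l M N (b : M -> N -> QZ) n : balanced b -> b 0 n = 0.
Proof. by case=> bl _ _; exact: zmod_morphism0 (bl n). Qed.

Lemma balanced0r M N (b : M -> N -> QZ) m : balanced b -> b m 0 = 0.
Proof. by case=> _ br _; exact: zmod_morphism0 (br m). Qed.

Lemma balanced_zero M N : balanced (fun (_ : M) (_ : N) => 0 : QZ).
Proof. by split=> // n x y; rewrite subr0. Qed.

(** Right exactness of the tensor product, read on characters. *)
Lemma balanced_factor A B Y (p : {linear A -> B}) (b : A -> Y -> QZ) :
  surj p -> balanced b -> (forall a y, p a = 0 -> b a y = 0) ->
  exists c : B -> Y -> QZ, balanced c /\ forall a y, c (p a) y = b a y.
Proof.
move=> pS [bl br bz] hb; pose s x := projT1 (cid (pS x)).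
have sE x : p (s x) = x by rewrite /s; case: cid.
have bE a a' y : p a = p a' -> b a y = b a' y.
  move=> E; apply/eqP; rewrite -subr_eq0 -bl; apply/eqP/hb.
  by rewrite linearB E subrr.
exists (fun x => b (s x)); split; last by move=> a y; apply: bE; rewrite sE.
split=> [n x y|m x y|r m n]; last 2 first.
- exact: br.
- by rewrite -bz; apply: bE; rewrite linearZ !sE.
by rewrite -bl; apply: bE; rewrite linearB !sE.
Qed.

(** One half of the Hom-tensor adjunction; [char_balanced] is the other. *)
Lemma balanced_char M N (b : M -> N -> QZ) : balanced b ->
  exists f : {linear M -> charmod N}, forall m n, char_val (f m) n = b m n.
Proof.
case=> bl br bz.
have fL : linear (fun m => mk_char (br m)).
  move=> r m m'; apply: char_eq => n; rewrite char_add char_scaleE !mk_charE.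
  by rewrite (zmod_morphismD (bl n)) bz.
by exists (mk_linear fL).
Qed.

Lemma char_balanced M N (f : {linear M -> charmod N}) :
  balanced (fun m n => char_val (f m) n).
Proof.
split=> [n x y|m|r m n]; first by rewrite linearB char_sub.
  exact: char_valB.
by rewrite linearZ char_scaleE.
Qed.

Lemma balanced_dsum (X : eqType) M N (c : X -> M -> N -> QZ) :
  (forall x, balanced (c x)) ->
  balanced (fun m (p : dsum X N) => dsum_fold (fun x => c x m) p).
Proof.
move=> cb; have cB m x : zmod_morphism (c x m) by case: (cb x).
split=> [p m m'|m|r m p].
- by rewrite /dsum_fold -sumrB; apply: eq_bigr => x _; case: (cb x) => ->.
- exact: dsum_fold_zmod_morphism.
- apply: (@dsum_ext _ _ _ _ _ (fun p => dsum_fold (fun x => c x m) (r *: p)))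
    => [|p1 p2|x a]; first exact: dsum_fold_zmod_morphism.
    by rewrite scalerBr dsum_fold_zmod_morphism.
  by rewrite -linearZ /= !dsum_fold_delta //; case: (cb x).
Qed.

Lemma balanced_dsum_ext (X : eqType) M N (b c : M -> dsum X N -> QZ) :
  balanced b -> balanced c ->
  (forall m x n, b m (dsum_delta x n) = c m (dsum_delta x n)) ->
  forall m p, b m p = c m p.
Proof. by move=> [_ br _] [_ cr _] h m; apply: dsum_ext => //; exact: h. Qed.

(** Dual form of the injectivity of [i] tensored with [Y]. *)
Definition extends A B (i : {linear A -> B}) Y : Prop :=
  forall b : A -> Y -> QZ, balanced b ->
  exists c : B -> Y -> QZ, balanced c /\ forall a y, c (i a) y = b a y.

Definition ses A B C (i : {linear A -> B}) (p : {linear B -> C}) : Prop :=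
  [/\ injective i, exact_at i p & surj p].

Lemma sesK A B C (i : {linear A -> B}) (p : {linear B -> C}) a : ses i p -> p (i a) = 0.
Proof. by case=> _ e _; apply/e; exists a. Qed.

(** Dual form of Tor_1(C, Y) = 0. All sequences ending in [C] are quantified over, but by
    [tor1_zero_from] and [tor1_zero_projective] one with projective middle term decides. *)
Definition tor1_zero C Y : Prop := forall A B (i : {linear A -> B}) (p : {linear B -> C}),
  ses i p -> extends i Y.

(** Flatness expressed by characters; [flatP] identifies it with [flat]. *)
Definition bflat M : Prop := forall A B (i : {linear A -> B}),
  injective i -> extends i M.

Definition projective M : Prop := forall B C (p : {linear B -> C}) (f : {linear M -> C}),
  surj p -> exists g : {linear M -> B}, forall m, p (g m) = f m.

Lemma kernel_ses A B (p : {linear A -> B}) : surj p -> ses (kernel_inc p) p.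
Proof. by split; [exact: kernel_inc_inj | exact: kernel_incP |]. Qed.

Lemma fst_linear A B : linear (@fst A B). Proof. by []. Qed.
Lemma snd_linear A B : linear (@snd A B). Proof. by []. Qed.

Lemma pair_linear A B C (f : {linear A -> B}) (g : {linear A -> C}) :
  linear (fun a => (f a, g a)).
Proof. by move=> r x y; rewrite !linearP. Qed.

Lemma zero_linear A B : linear (fun _ : A => 0 : B).
Proof. by move=> r x y; rewrite scaler0 addr0. Qed.

Definition zero_map A B : {linear A -> B} := mk_linear (@zero_linear A B).

(** Two short exact sequences ending in [C] are compared through their pullback. *)
Lemma tor1_zero_from A B C Y (i : {linear A -> B}) (p : {linear B -> C}) :
  ses i p -> tor1_zero B Y -> extends i Y -> tor1_zero C Y.
Proof.
move=> sip tB ei A' B' i' p' sip' b bb.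
have [iI ie ps] := sip; have [iI' ie' ps'] := sip'.
(* [Q] is the pullback of [p'] and [p]; below, [k] embeds [A'] as the kernel of [q2], and [l] embeds
   [A] as the kernel of [q1]. *)
have dL : linear (fun z : B' * B => p' z.1 - p z.2).
  by move=> r x y /=; rewrite !linearP /= scalerDr addrACA.
pose d := mk_linear dL; pose Q := kernel d; pose j : {linear Q -> _} := kernel_inc d.
pose fstL := mk_linear (@fst_linear B' B); pose sndL := mk_linear (@snd_linear B' B).
pose q1 : {linear Q -> B'} := fstL \o j; pose q2 : {linear Q -> B} := sndL \o j.
have q12 z : p' (q1 z) = p (q2 z).
  by have := kernel_incK z => /eqP; rewrite subr_eq0 => /eqP.
have mkQ x y : p' x = p y -> exists z : Q, q1 z = x /\ q2 z = y.
  move=> E; have [|z zE] := (kernel_incP d (x, y)).1.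
    by rewrite /d mk_linearE /= E subrr.
  by exists z; rewrite /q1 /q2 /= -/j /j zE.
have [||k kE] := @factor_inj _ _ _ _ j (mk_linear (pair_linear i' (zero_map A' B))).
- exact: kernel_inc_inj.
- by move=> a; apply/kernel_incP; rewrite !mk_linearE /= (sesK _ sip') linear0 subr0.
have [||l lE] := @factor_inj _ _ _ _ j (mk_linear (pair_linear (zero_map A B') i)).
- exact: kernel_inc_inj.
- by move=> a; apply/kernel_incP; rewrite !mk_linearE /= (sesK _ sip) linear0 subr0.
have k1 a : q1 (k a) = i' a by rewrite /q1 /= kE.
have k2 a : q2 (k a) = 0 by rewrite /q2 /= kE.
have l1 a : q1 (l a) = 0 by rewrite /q1 /= lE.
have l2 a : q2 (l a) = i a by rewrite /q2 /= lE.
have jE z z' : q1 z = q1 z' -> q2 z = q2 z' -> z = z'.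
  move=> E1 E2; apply: (@kernel_inc_inj _ _ _ d).
  by rewrite [LHS]surjective_pairing [RHS]surjective_pairing; congr (_, _).
have sk : ses k q2.
  split; first by move=> a a' E; apply: iI'; rewrite -!k1 E.
    move=> z; split=> [z2|[a <-]]; last exact: k2.
    have [|a aE] := (ie' (q1 z)).1; first by rewrite q12 z2 linear0.
    by exists a; apply: jE; rewrite ?k1 ?k2.
  by move=> y; have [x xE] := ps' (p y); have [z [_ <-]] := mkQ _ _ xE; exists z.
(* Extend [b] along [k] to [h] on [Q]. Subtracting an extension [g] of its restriction to [A] makes
   it vanish on the kernel of [q1], so it descends to [B']; on [A'] nothing changes since [q2] is
   zero there. *)
have [h [bh hE]] := tB _ _ _ _ sk b bb.
have [g [bg gE]] := ei _ (balanced_compl l bh).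
have [|||c [bc cE]] := @balanced_factor _ _ _ q1 (fun z y => h z y - g (q2 z) y).
- move=> x; have [y yE] := ps (p' x); have [z [<- _]] := mkQ _ _ (esym yE); by exists z.
- exact: balancedB bh (balanced_compl q2 bg).
- move=> z y z1; have [|a aE] := (ie (q2 z)).1; first by rewrite -q12 z1 linear0.
  have -> : z = l a by apply: jE; rewrite ?l1 ?l2.
  by rewrite l2 gE subrr.
exists c; split=> // a y.
by rewrite -k1 cE k2 hE balanced0l // subr0.
Qed.

(** The sequence splits, and [b] is composed with the retraction onto [A]. *)
Lemma tor1_zero_projective P Y : projective P -> tor1_zero P Y.
Proof.
move=> pP A B i p sip b bb; have [iI ie ps] := sip.
have idL : linear (@id P) by [].
have [s sE] := pP _ _ p (mk_linear idL) ps.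
have rL : linear (fun x => x - s (p x)).
  by move=> r x y; rewrite !linearP /= scalerDr addrACA.
have [x|t tE] := @factor_inj _ _ _ _ i (mk_linear rL) iI.
  by apply/ie; rewrite mk_linearE linearB sE mk_linearE subrr.
exists (fun x y => b (t x) y); split; first exact: balanced_compl.
move=> a y; congr b; apply: iI; rewrite tE mk_linearE (sesK _ sip) linear0.
by rewrite subr0.
Qed.

(** A balanced map on [A] and [R] is determined by its character at 1, which extends because [QZ] is
    injective as a group. *)
Lemma bflat_regular : bflat R^o.
Proof.
move=> A B i iI b [bl br bz].
have iB : zmod_morphism i by move=> x y; rewrite linearB.
have [g [gB gE]] := QZ_extend iB iI (bl (1 : R^o)).
exists (fun x r => g (r *: x)); split=> [|a r].
  split=> [r x y|x r r'|r x r']; rewrite ?scalerBr ?scalerBl ?gB //.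
  by rewrite scalerA mulrC.
by rewrite -linearZ gE bz /= [r *: _]mulr1.
Qed.

Lemma bflat_dsum (X : eqType) M : bflat M -> bflat (dsum X M).
Proof.
move=> fM A B i iI b bb.
have h x : exists c : B -> M -> QZ, balanced c /\
    forall a m, c (i a) m = b a (dsum_delta x m).
  exact: (fM _ _ _ iI _ (balanced_compr (@dsum_delta R X M x) bb)).
pose c x := projT1 (cid (h x)).
have bc x : balanced (c x) by rewrite /c; case: cid => ? [].
have cE x a m : c x (i a) m = b a (dsum_delta x m).
  by rewrite /c; case: cid => ? [] /=.
have bf := balanced_dsum bc; exists (fun m p => dsum_fold (fun x => c x m) p).
split=> //; apply: (balanced_dsum_ext (balanced_compl i bf) bb) => a x m.
by rewrite dsum_fold_delta // => y; case: (bc y).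
Qed.

Lemma bflat_prod M N : bflat M -> bflat N -> bflat (M * N)%type.
Proof.
move=> fM fN A B i iI b bb.
have mL : linear (fun m : M => (m, 0 : N)).
  by move=> r x y; rewrite -[RHS]/(r *: x + y, r *: 0 + 0) scaler0 addr0.
have nL : linear (fun n : N => (0 : M, n)).
  by move=> r x y; rewrite -[RHS]/(r *: 0 + 0, r *: x + y) scaler0 addr0.
have [c [bc cE]] := fM _ _ _ iI _ (balanced_compr (mk_linear mL) bb).
have [d [bd dE]] := fN _ _ _ iI _ (balanced_compr (mk_linear nL) bb).
exists (fun x z => c x z.1 + d x z.2); split.
  case: bc bd => cl cr cz [dl dr dz]; split=> [z x y|x z z'|r x z] /=.
  - by rewrite cl dl opprD addrACA.
  - by rewrite cr dr opprD addrACA.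
  - by rewrite cz dz.
move=> a [m n] /=; rewrite cE dE !mk_linearE; case: bb => _ br _.
by rewrite -(zmod_morphismD (br a)); congr b; congr (_, _); rewrite ?addr0 ?add0r.
Qed.

Definition free M : lmodType R := dsum M R^o.

Lemma free_lift M N (f : M -> N) :
  exists g : {linear free M -> N}, forall x, g (dsum_delta x (1 : R^o)) = f x.
Proof.
have fL x : linear (fun r : R^o => r *: f x).
  by move=> a r s; rewrite scalerDl scalerA.
have [g gE] := dsum_lift (fun x => mk_linear (fL x)).
by exists g => x; rewrite gE mk_linearE scale1r.
Qed.

Lemma free_ext M N (f g : {linear free M -> N}) :
  (forall x, f (dsum_delta x (1 : R^o)) = g (dsum_delta x (1 : R^o))) -> f =1 g.
Proof.
move=> h; apply: dsum_ext => [x y|x y|x r]; rewrite ?linearB //.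
have -> : dsum_delta x r = r *: dsum_delta x (1 : R^o).
  by rewrite -linearZ /= [r *: _]mulr1.
by rewrite !linearZ h.
Qed.

Lemma free_projective M : projective (free M).
Proof.
move=> B C p f ps; pose s x := projT1 (cid (ps x)).
have sE x : p (s x) = x by rewrite /s; case: cid.
have [g gE] := free_lift (fun m => s (f (dsum_delta m (1 : R^o)))).
by exists g; apply: (@free_ext _ _ (p \o g)) => x; rewrite /= gE sE.
Qed.

Lemma free_bflat M : bflat (free M).
Proof. exact/bflat_dsum/bflat_regular. Qed.

Definition free_proj M : {linear free M -> M} := projT1 (cid (free_lift (@id M))).

Lemma free_proj_surj M : surj (free_proj M).
Proof.
by move=> x; exists (dsum_delta x (1 : R^o)); rewrite /free_proj; case: cid.
Qed.

Definition syz M : lmodType R := kernel (free_proj M).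

Lemma syz_ses M : ses (kernel_inc (free_proj M)) (free_proj M).
Proof. exact/kernel_ses/free_proj_surj. Qed.

(** Balancing of Tor, by a diagram chase between free presentations of both variables. *)
Lemma tor1_zeroC C Y : tor1_zero C Y -> tor1_zero Y C.
Proof.
have presentation M : exists (K P : lmodType R) (j : {linear K -> P})
    (q : {linear P -> M}), [/\ ses j q, projective P & bflat P].
  exists (syz M), (free M), (kernel_inc (free_proj M)), (free_proj M).
  by split; [exact: syz_ses | exact: free_projective | exact: free_bflat].
move=> tCY; have [Y' [P [j [q [sjq pP _]]]]] := presentation Y.
have [A [B [i [p [sip _ fB]]]]] := presentation C.
apply: (tor1_zero_from sjq); first exact: tor1_zero_projective.
move=> b bb; have [jI je qS] := sjq; have [_ ie pS] := sip.
(* By flatness of [B], [b] pulled back along [p] extends to [g] on [P] and [B]. On [P] and [A] it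
   descends to [d0] on [Y] and [A], which the hypothesis extends to [d]. Then [g] minus [d] pulled
   back along [q] vanishes on [A], hence descends to [C], and restricts to [b] on [Y']. *)
have [g [bg gE]] := fB _ _ _ jI _ (balanced_compr p bb).
have [|d0 [bd0 d0E]] := balanced_factor qS (balanced_compr i bg).
  move=> x a /je[z <-].
  by rewrite gE (sesK _ sip) balanced0r.
have [d [/balancedC bd dE]] := tCY _ _ _ _ sip _ (balancedC bd0).
have bgd := balancedC (balancedB bg (balanced_compl q bd)).
have [|c [/balancedC bc cE]] := balanced_factor pS bgd.
  move=> x y /ie[z <-].
  by rewrite dE d0E subrr.
exists (fun y x => c x y); split=> // a y; have [x <-] := pS y.
by rewrite cE gE (sesK _ sjq) (balanced0l _ bd) subr0.
Qed.

Lemma bflat_tor1_zero M C : bflat M -> tor1_zero C M.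
Proof. by move=> fM A B i p [iI _ _]; exact: fM. Qed.

Lemma cokernel_exists A B (i : {linear A -> B}) :
  exists (C : lmodType R) (p : {linear B -> C}), surj p /\ exact_at i p.
Proof.
exists (qspan (fun y => exists x, i x = y)), (qproj (fun y => exists x, i x = y)).
split; first by move=> y; exists (qrepr y); exact: qreprK.
move=> y; split=> [|[x <-]].
  rewrite -(linear0 (qproj _)) => /qproj_eq; rewrite subr0.
  elim=> [|a u v [x <-] _ [x' <-]]; first by exists 0; rewrite linear0.
  by exists (a *: x + x'); rewrite linearP.
rewrite -(linear0 (qproj _)); apply/qproj_eq; rewrite subr0.
by apply: span_gen; exists x.
Qed.

Lemma bflatP M : bflat M <-> forall C, tor1_zero C M.
Proof.
split=> [fM C|h A B i iI]; first exact: bflat_tor1_zero.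
by have [C [p [ps e]]] := cokernel_exists i; apply: (h C _ _ i p).
Qed.

Lemma tor1_zero_bflat M C : bflat M -> tor1_zero M C.
Proof. by move=> fM; exact/tor1_zeroC/bflat_tor1_zero. Qed.

Section TwoSequences.
Variables (A B C Y' P Y : lmodType R).
Variables (i : {linear A -> B}) (p : {linear B -> C}).
Variables (j : {linear Y' -> P}) (q : {linear P -> Y}).
Hypotheses (sip : ses i p) (sjq : ses j q) (fP : bflat P).

(** Exactness of [Tor_2(B,Y) -> Tor_2(C,Y) -> Tor_1(A,Y)], where
    [Tor_2(-,Y) = Tor_1(-,Y')]. *)
Lemma tor1_zero_quot : tor1_zero A Y -> tor1_zero B Y' -> tor1_zero C Y'.
Proof.
move=> tA tB; apply: (tor1_zero_from sip tB) => b bb.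
(* From [Y'] to [P] by the vanishing for [A], then from [A] to [B] by flatness of [P]. *)
have [c [/balancedC bc cE]] := tor1_zeroC tA sjq (balancedC bb).
have [iI _ _] := sip; have [d [bd dE]] := fP iI bc.
exists (fun x y => d x (j y)); split; first exact: balanced_compr.
by move=> a y; rewrite dE cE.
Qed.

(** Exactness of [Tor_2(C,Y) -> Tor_1(A,Y) -> Tor_1(B,Y)]. *)
Lemma tor1_zero_sub : tor1_zero C Y' -> tor1_zero B Y -> tor1_zero A Y.
Proof.
move=> tC tB; apply: tor1_zeroC; apply: (tor1_zero_from sjq).
  exact: tor1_zero_bflat.
move=> b bb; have [c [/balancedC bc cE]] := tC _ _ _ _ sip _ (balancedC bb).
have [d [bd dE]] := tor1_zeroC tB sjq bc.
exists (fun x a => d x (i a)); split; first exact: balanced_compr.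
by move=> y a; rewrite dE cE.
Qed.

End TwoSequences.

End Balanced.

(** * Tensor exactness, flatness and enough injectives *)

Section TensorExact.
Variables (R : comNzRingType) (M : lmodType R).
Implicit Types A B C Z : lmodType R.

(** [QZ] is not an [R]-module, so the universal property is applied with values in [charmod R^o],
    followed by evaluation at 1. *)
Lemma balanced_tensor B (b : B -> M -> QZ) : balanced b ->
  exists F : tensor B M -> QZ, zmod_morphism F /\ forall x m, F (tens x m) = b x m.
Proof.
case=> bl br bz.
have bB x m : zmod_morphism (fun r : R^o => b (r *: x) m).
  by move=> r s; rewrite scalerBl bl.
have [||||f fE] := @tens_lift_exists R B M (charmod R^o) (fun x m => mk_char (bB x m)).
- by move=> x x' m; apply: char_eq => r; rewrite char_add !mk_charE scalerDr
    (zmod_morphismD (bl m)).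
- by move=> x m m'; apply: char_eq => r; rewrite char_add !mk_charE
    (zmod_morphismD (br _)).
- by move=> a x m; apply: char_eq => r; rewrite char_scaleE !mk_charE scalerA mulrC.
- by move=> a x m; apply: char_eq => r; rewrite char_scaleE !mk_charE -bz scalerA.
exists (fun t => char_val (f t) (1 : R^o)); split=> [x y|x m].
  by rewrite linearB char_sub.
by rewrite fE mk_charE scale1r.
Qed.

Lemma tensor_balanced B (F : tensor B M -> QZ) : zmod_morphism F ->
  balanced (fun x m => F (tens x m)).
Proof.
move=> FB; have FD := zmod_morphismD FB.
split=> [m x x'|x m m'|r x m].
- by rewrite -FB; congr F; apply/eqP; rewrite eq_sym subr_eq -tensDl subrK.
- by rewrite -FB; congr F; apply/eqP; rewrite eq_sym subr_eq -tensDr subrK.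
- by rewrite tensZl tensZr.
Qed.

Lemma tensor_fun_eq B (F G : tensor B M -> QZ) : zmod_morphism F -> zmod_morphism G ->
  (forall x m, F (tens x m) = G (tens x m)) -> F =1 G.
Proof.
move=> FB GB h t; have [s ->] := tens_spanP t.
by rewrite !zmod_morphism_sum //; apply: eq_bigr => p _; exact: h.
Qed.

(** Duality with [QZ] reflects exactness, because characters extend from subgroups and separate
    points from subgroups. *)
Lemma tensor_exactP A B C (f : {linear A -> B}) (g : {linear B -> C}) :
  (forall a, g (f a) = 0) ->
  exact_at (tensor_map M f) (tensor_map M g) <->
  forall b : B -> M -> QZ, balanced b -> (forall a m, b (f a) m = 0) ->
    exists c : C -> M -> QZ, balanced c /\ forall x m, c (g x) m = b x m.
Proof.
move=> gf; set tf := tensor_map M f; set tg := tensor_map M g.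
have tfB (F : tensor B M -> QZ) : zmod_morphism F -> zmod_morphism (F \o tf).
  by move=> FB x y /=; rewrite linearB FB.
have tgB (F : tensor C M -> QZ) : zmod_morphism F -> zmod_morphism (F \o tg).
  by move=> FB x y /=; rewrite linearB FB.
have F0 (F : tensor B M -> QZ) : zmod_morphism F -> (forall a m, F (tens (f a) m) = 0) ->
    forall t, F (tf t) = 0.
  move=> FB h; apply: (tensor_fun_eq (tfB _ FB)) => [x y|x m]; first by rewrite subr0.
  by rewrite /= tensor_mapE h.
split=> [ex b bb bf|h t].
  have [F [FB FE]] := balanced_tensor bb.
  have Ff : forall t, F (tf t) = 0 by apply: F0 => // a m; rewrite FE.
  (* [F] kills the image of [tf], which is the kernel of [tg], so it is a well-defined character on
     the image of [tg]. *)
  have [|H [HB HE]] := @pgraph_total (tensor C M) (fun z => exists t, z = (tg t, F t)).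
    split; [split|].
    - by exists 0; rewrite linear0 (zmod_morphism0 FB).
    - by move=> _ _ [x ->] [y ->]; exists (x - y); rewrite linearB FB.
    - by move=> u [t [/esym/ex[x <-] ->]].
  exists (fun y m => H (tens y m)); split; first exact: tensor_balanced.
  by move=> x m; rewrite -tensor_mapE -FE; apply: HE; exists (tens x m).
split=> [t0|[x <-]]; last first.
  have [s ->] := tens_spanP x; rewrite !linear_sum big1 // => p _ /=.
  by rewrite !tensor_mapE gf -[0](scale0r 0) tensZl scale0r.
(* Otherwise a character killing the image of [tf] but not [t] would factor through [tg], although
   [tg] kills [t]. *)
apply: contrapT => nt.
have [|F [FB Fim Ft]] := @QZ_separate _ (fun y => exists x, tf x = y) t _ nt.
  split; first by exists 0; rewrite linear0.
  by move=> _ _ [x <-] [y <-]; exists (x - y); rewrite linearB.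
have [a m|c [bc cE]] := h _ (tensor_balanced FB).
  by apply: Fim; exists (tens a m); rewrite /tf tensor_mapE.
have [H [HB HE]] := balanced_tensor bc.
apply: Ft; rewrite -(tensor_fun_eq (tgB _ HB) FB _ t).
  by rewrite /= t0 zmod_morphism0.
by move=> x m; rewrite /= tensor_mapE HE cE.
Qed.

(** [q] corestricts the second map onto its image and [j] embeds that image. *)
Lemma splice_tensor_exact A B C Z (f : {linear A -> B}) (q : {linear B -> Z})
    (j : {linear Z -> C}) :
  exact_at f q -> surj q -> extends j M ->
  exact_at (tensor_map M f) (tensor_map M (j \o q)).
Proof.
move=> e qS ej; apply/tensor_exactP => [a|b bb bf].
  by rewrite /= (e _).2 ?linear0 //; exists a.
have [a y /e[x <-] //|c [bc cE]] := balanced_factor qS bb.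
have [d [bd dE]] := ej _ bc; exists d; split=> // x m.
by rewrite /= dE cE.
Qed.

Lemma flatP : flat M <-> bflat M.
Proof.
split=> [fM A B i iI b bb|fM A B C f g e].
  (* Injectivity of [i] is exactness of a sequence starting with a zero map. *)
  have e : exact_at (zero_map A A) i.
    move=> x; split=> [ix|[y <-]]; last by rewrite mk_linearE linear0.
    by exists 0; rewrite mk_linearE; apply: iI; rewrite ix linear0.
  have [|h _] := @tensor_exactP _ _ _ (zero_map A A) i.
    by move=> a; rewrite mk_linearE linear0.
  by apply: (h (fM _ _ _ _ _ e) b bb) => a m; rewrite mk_linearE balanced0l.
apply/tensor_exactP => [a|b bb bf]; first by apply/e; exists a.
(* By exactness [g] is the projection [p] onto the cokernel of [f] followed by an injection [h];
   flatness is applied to [h]. *)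
have [Q [p [pS ep]]] := cokernel_exists f.
have [|h hE] := @factor_surj _ _ _ _ p g pS.
  by move=> a /ep[x <-]; apply/e; exists x.
have hI : injective h.
  move=> x y; have [x' <-] := pS x; have [y' <-] := pS y; rewrite !hE => E.
  apply/eqP; rewrite -subr_eq0 -linearB; apply/eqP/ep/e.
  by rewrite linearB E subrr.
have [a y /ep[x <-] //|c [bc cE]] := balanced_factor pS bb.
have [d [bd dE]] := fM _ _ _ hI _ bc.
by exists d; split=> // x m; rewrite -hE dE cE.
Qed.

End TensorExact.

Section Injectives.
Variable R : comNzRingType.
Implicit Types M N : lmodType R.

Lemma charmod_injective N : bflat N -> injective_module (charmod N).
Proof.
move=> fN A B i f iI; have [c [bc cE]] := fN _ _ _ iI _ (char_balanced f).
have [g gE] := balanced_char bc; exists g => x.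
by apply: char_eq => n; rewrite gE cE.
Qed.

(** [M] is sent to the characters of the free module on [charmod M]: the generator [f] yields the
    value of [f]. Characters separate points, so this is injective; the target is the character
    module of a flat module. *)
Lemma enough_injectives M : exists (E : lmodType R) (i : {linear M -> E}),
  injective_module E /\ injective i.
Proof.
pose F := free (charmod M).
have cb (f : charmod M) : balanced (fun (m : M) (r : R^o) => char_val f (r *: m)).
  split=> [r m m'|m r r'|s m r].
  - by rewrite scalerBr char_valB.
  - by rewrite scalerBl char_valB.
  - by rewrite scalerA mulrC.
have [i iE] := balanced_char (balanced_dsum cb).
exists (charmod F), i; split; first exact/charmod_injective/free_bflat.
move=> x y E; apply: contrapT => xy.
have [||g [gB _ gx]] := @QZ_separate M (fun z => z = 0) (x - y).
- by split=> // _ _ -> ->; rewrite subr0.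
- by move/eqP; rewrite subr_eq0 => /eqP.
apply: gx; rewrite gB; apply/eqP; rewrite subr_eq0; apply/eqP.
have := congr1 (fun h => char_val h (dsum_delta (mk_char gB) (1 : R^o))) E.
have cB (z : M) (f : charmod M) : zmod_morphism (fun r : R^o => char_val f (r *: z)) by case: (cb f).
by rewrite !iE !dsum_fold_delta // !mk_charE !scale1r.
Qed.

End Injectives.

(** * Gorenstein weak dimension and injectives *)

Section FlatDimension.
Variable R : comNzRingType.
Implicit Types A B C D G I K M N P Y : lmodType R.

Definition syzn n M : lmodType R := iter n (@syz R) M.

Lemma syznSr n M : syzn n.+1 M = syzn n (syz M).
Proof. exact: iterSr. Qed.

Lemma syzn_add m n M : syzn m (syzn n M) = syzn (m + n) M.
Proof. by rewrite /syzn iterD. Qed.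

(** Both sides express Tor_2(M, N) = 0, by dimension shifting in either variable. *)
Lemma tor1_zero_syz M N : tor1_zero (syz M) N <-> tor1_zero M (syz N).
Proof.
split=> h.
  apply: (tor1_zero_quot (syz_ses M) (syz_ses N)) => //; first exact: free_bflat.
  exact/tor1_zero_bflat/free_bflat.
apply: (tor1_zero_sub (syz_ses M) (syz_ses N)) => //; first exact: free_bflat.
exact/tor1_zero_bflat/free_bflat.
Qed.

Lemma tor1_zero_syzn n M N : tor1_zero (syzn n M) N <-> tor1_zero M (syzn n N).
Proof.
elim: n N => // n IH N; rewrite [syzn n.+1 N]syznSr.
by split=> [/tor1_zero_syz/IH //|/IH/tor1_zero_syz].
Qed.

(** [Tor_(n+1)(M, N) = 0] for all [N]. *)
Definition fd_le n M : Prop := forall N, tor1_zero M (syzn n N).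

Lemma bflat_fd_le n M : bflat M -> fd_le n M.
Proof. by move=> fM N; exact: tor1_zero_bflat. Qed.

Lemma fd_le0 M : fd_le 0 M -> bflat M.
Proof. by move=> h; apply/bflatP => C; exact/tor1_zeroC/h. Qed.

Lemma fd_le_leq m n M : (m <= n)%N -> fd_le m M -> fd_le n M.
Proof. by move=> mn h N; rewrite -(subnKC mn) -syzn_add; exact: h. Qed.

Lemma fd_le_syz n M : fd_le n (syz M) <-> fd_le n.+1 M.
Proof. by split=> h N; [apply/tor1_zero_syz/h | exact/tor1_zero_syz/(h N)]. Qed.

Lemma fd_le_quot n A B C (i : {linear A -> B}) (p : {linear B -> C}) :
  ses i p -> fd_le n A -> fd_le n.+1 B -> fd_le n.+1 C.
Proof.
move=> sip fA fB N; apply: (tor1_zero_quot sip (syz_ses _)).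
- exact: free_bflat.
- exact: (fA N).
- exact: (fB N).
Qed.

Lemma fd_le_sub n A B C (i : {linear A -> B}) (p : {linear B -> C}) :
  ses i p -> fd_le n.+1 C -> fd_le n B -> fd_le n A.
Proof.
move=> sip fC fB N; apply: (tor1_zero_sub sip (syz_ses _)).
- exact: free_bflat.
- exact: (fC N).
- exact: (fB N).
Qed.

Definition injectives_fd_le n : Prop :=
  forall I, injective_module I -> fd_le n I.

(** [L] is a syzygy of [B] for the cover by the product of the free covers of [A] and [C]. It need
    not be [syz B], so only the flatness of [P] is recorded. *)
Lemma horseshoe A B C (i : {linear A -> B}) (p : {linear B -> C}) : ses i p ->
  exists (L P : lmodType R) (a : {linear syz A -> L}) (c : {linear L -> syz C})
    (j : {linear L -> P}) (q : {linear P -> B}), [/\ ses a c, ses j q & bflat P].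
Proof.
move=> sip; have [iI ie pS] := sip.
have sA := syz_ses A; have sC := syz_ses C.
set pA := free_proj A in sA; set pC := free_proj C in sC.
set iA := kernel_inc pA in sA; set iC := kernel_inc pC in sC.
have [s sE] := @free_projective _ C _ _ p pC pS.
have qL : linear (fun z : free A * free C => i (pA z.1) + s z.2).
  by move=> r x y /=; rewrite !linearP /= scalerDr addrACA.
pose q := mk_linear qL; pose j := kernel_inc q.
have qE z : q z = i (pA z.1) + s z.2 by [].
have jE l : i (pA (j l).1) + s (j l).2 = 0 by exact: (kernel_incK l).
have jP z : q z = 0 -> exists l, j l = z by move=> qz; apply/kernel_incP.
have pC0 l : pC (j l).2 = 0.
  have := congr1 p (jE l); rewrite linearD linear0 (sesK _ sip) add0r.
  by rewrite sE.
have [iAI eA _] := sA; have [iCI eC _] := sC.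
have [||a aE] := @factor_inj _ _ _ _ j (mk_linear (pair_linear iA (zero_map _ (free C)))).
- exact: kernel_inc_inj.
- by move=> x; apply: jP; rewrite qE !mk_linearE /= (sesK _ sA) !linear0 addr0.
pose sndj : {linear kernel q -> free C} := mk_linear (@snd_linear _ _ _) \o j.
have [|c cE] := @factor_inj _ _ _ _ iC sndj iCI.
  by move=> l; apply/eC; exact: pC0.
have cE' l : iC (c l) = (j l).2 by rewrite cE.
have aE' x : j (a x) = (iA x, 0) by rewrite aE.
exists (kernel q), _, a, c, j, q; split; last exact/bflat_prod/free_bflat/free_bflat.
- split=> [x y E|l|y].
  + by apply: iAI; have := congr1 j E; rewrite !aE' => -[].
  + split=> [cl|[x <-]]; last by apply: iCI; rewrite cE' aE' linear0.
    have j2 : (j l).2 = 0 by rewrite -cE' cl linear0.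
    have /eA[x xE] : pA (j l).1 = 0.
      by apply: iI; have := jE l; rewrite j2 linear0 addr0 => ->; rewrite linear0.
    exists x; apply: (@kernel_inc_inj _ _ _ q).
    by rewrite -/j aE' xE -j2 -surjective_pairing.
  (* For [y] in [syz C], the element [s (iC y)] comes from [A]; lifting it to [x] in the free cover
     puts [(- x, iC y)] in [L]. *)
  + have [|a' a'E] := (ie (s (iC y))).1; first by rewrite sE (sesK _ sC).
    have [x xE] := @free_proj_surj _ A a'.
    have [|l lE] := jP (- x, iC y).
      by rewrite qE /= !linearN xE a'E addNr.
    by exists l; apply: iCI; rewrite cE' lE.
- apply: kernel_ses => b.
  have [y yE] := @free_proj_surj _ C (p b).
  have [|a' a'E] := (ie (b - s y)).1; first by rewrite linearB sE /pC yE subrr.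
  have [x xE] := @free_proj_surj _ A a'.
  by exists (x, y); rewrite qE /= xE a'E subrK.
Qed.

Lemma horseshoe_iter n A B C (i : {linear A -> B}) (p : {linear B -> C}) :
  ses i p -> fd_le n B ->
  exists (L : lmodType R) (a : {linear syzn n A -> L}) (c : {linear L -> syzn n C}),
    ses a c /\ bflat L.
Proof.
elim: n A B C i p => [|n IH] A B C i p sip fB.
  by exists B, i, p; split=> //; exact: fd_le0.
have [L [P [a [c [j [q [sac sjq fP]]]]]]] := horseshoe sip.
rewrite !syznSr; apply: (IH _ _ _ _ _ sac).
(* As the kernel of a flat cover of [B], [L] has flat dimension one less. *)
by apply: fd_le_sub sjq fB _; exact: bflat_fd_le.
Qed.

End FlatDimension.

(** * Complete flat resolutions and Gorenstein flat resolutions *)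

Section GorensteinFlat.
Variable R : comNzRingType.
Implicit Types A B C D G I K M N P Y : lmodType R.

Lemma splice_exact A B C D (f : {linear A -> B}) (q : {linear B -> C})
    (j : {linear C -> D}) :
  exact_at f q -> injective j -> exact_at f (j \o q).
Proof.
move=> e jI x; split=> [jq|/e qx]; last by rewrite /= qx linear0.
by apply/e/jI; rewrite linear0.
Qed.

Lemma ses_exact_comp A B C D (j : {linear B -> C}) (p : {linear C -> D})
    (q : {linear A -> B}) :
  ses j p -> surj q -> exact_at (j \o q) p.
Proof.
move=> sjp qS x; have [_ e _] := sjp; split=> [/e[y <-]|[y <-]].
  by have [z <-] := qS y; exists z.
by rewrite /= (sesK _ sjp).
Qed.

Section Coresolution.
Variable P : lmodType R -> Prop.
Hypothesis P_tor : forall C I j, P C -> injective_module I -> tor1_zero (syzn j C) I.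
Hypothesis P_step : forall C, P C -> exists (L D : lmodType R)
  (i : {linear C -> L}) (p : {linear L -> D}), [/\ ses i p, bflat L & P D].

Record stage := Stage {stage_mod : lmodType R; stageP : P stage_mod}.

Record stage_step (s : stage) := StageStep {
  step_flat : lmodType R;
  step_next : stage;
  step_inc : {linear stage_mod s -> step_flat};
  step_proj : {linear step_flat -> stage_mod step_next};
  step_ses : ses step_inc step_proj;
  step_bflat : bflat step_flat
}.

(** Wrapping the data in a trivial existential lets [cid] choose a step, so that steps can be
    iterated. *)
Lemma stage_step_exists s : exists t : stage_step s, True.
Proof.
have [L [D [i [p [sip fL PD]]]]] := P_step (stageP s).
by exists (@StageStep s L (Stage PD) i p sip fL).
Qed.

Definition the_step s : stage_step s := projT1 (cid (stage_step_exists s)).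

(** A free resolution of [C] is spliced with the coresolution obtained by iterating the chosen
    steps. *)
Lemma gorenstein_flat_coresolution C : P C -> gorenstein_flat C.
Proof.
move=> PC; pose st n := iter n (fun s => step_next (the_step s)) (Stage PC).
pose inc n := step_inc (the_step (st n)).
pose prj n : {linear step_flat (the_step (st n)) -> stage_mod (st n.+1)} :=
  step_proj (the_step (st n)).
have sst n : ses (inc n) (prj n) by exact: step_ses.
pose lo n := free (syzn n C); pose pr n : {linear lo n -> syzn n C} := free_proj _.
pose ki n : {linear syzn n.+1 C -> lo n} := kernel_inc _.
have slo n : ses (ki n) (pr n) by exact: syz_ses.
have prS n : surj (pr n) by exact: free_proj_surj.
have prjS n : surj (prj n) by have [] := sst n.
have incI n : injective (inc n) by have [] := sst n.
have kiI n : injective (ki n) by have [] := slo n.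
pose F := @TwoSided R lo (fun n => step_flat (the_step (st n)))
  (fun n => ki n \o pr n.+1) (inc 0%N \o pr 0%N) (fun n => inc n.+1 \o prj n).
have exl n : exact_at (ki n.+1 \o pr n.+2) (pr n.+1).
  exact: ses_exact_comp (slo n.+1) (prS n.+2).
have exl0 : exact_at (ki 0%N \o pr 1%N) (pr 0%N) by exact: ses_exact_comp (slo 0%N) (prS 1%N).
have exu0 : exact_at (inc 0%N \o pr 0%N) (prj 0%N) by exact: ses_exact_comp (sst 0%N) (prS 0%N).
have exu n : exact_at (inc n.+1 \o prj n) (prj n.+1).
  exact: ses_exact_comp (sst n.+1) (prjS n).
exists F; split.
- split=> n; apply/flatP; first exact: free_bflat.
  exact: step_bflat.
- split=> [n|||n].
  + exact: (splice_exact (exl n) (@kiI n)).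
  + exact: (splice_exact exl0 (@incI 0%N)).
  + exact: (splice_exact exu0 (@incI 1%N)).
  + exact: (splice_exact (exu n) (@incI n.+2)).
- exists (inc 0%N); split; first exact: incI.
  move=> y; split=> [[x <-]|[z <-]]; last by exists (pr 0%N z).
  by have [z <-] := prS 0%N x; exists z.
- move=> I injI.
  (* The cokernel of [inc n] is the next stage, again in [P]; that of [ki n] is an iterated syzygy
     of [C]. [P_tor] covers both. *)
  have exti n : extends (inc n) I.
    exact: (P_tor (j := 0) (stageP (st n.+1)) injI (sst n)).
  have extk n : extends (ki n) I by exact: (P_tor (j := n) PC injI (slo n)).
  split=> [n|||n].
  + exact: (splice_tensor_exact (exl n) (@prS n.+1) (extk n)).
  + exact: (splice_tensor_exact exl0 (@prS 0%N) (exti 0%N)).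
  + exact: (splice_tensor_exact exu0 (@prjS 0%N) (exti 1%N)).
  + exact: (splice_tensor_exact (exu n) (@prjS n.+1) (exti n.+2)).
Qed.

End Coresolution.

Definition zero_module : lmodType R := 'rV[R]_0.

Lemma zero_moduleE (x y : zero_module) : x = y.
Proof. by rewrite [x]thinmx0 [y]thinmx0. Qed.

(** Taken in the class of flat modules, each step embeds [C] in itself with zero cokernel. *)
Lemma bflat_gorenstein_flat M : bflat M -> gorenstein_flat M.
Proof.
apply: gorenstein_flat_coresolution => {M} [C I j fC _|C fC].
  exact/tor1_zero_syzn/tor1_zero_bflat.
have idL : linear (@id C) by [].
exists C, zero_module, (mk_linear idL), (zero_map C zero_module); split=> //.
  split=> // [x|y]; first by split=> _; [exists x | exact: zero_moduleE].
  by exists 0; exact: zero_moduleE.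
move=> A B i _ b bb; exists (fun _ _ => 0); split; first exact: balanced_zero.
by move=> a y; rewrite (zero_moduleE y 0) balanced0r.
Qed.

Lemma syzn_gorenstein_flat n M : injectives_fd_le R n -> gorenstein_flat (syzn n M).
Proof.
move=> hn.
apply: (@gorenstein_flat_coresolution (fun C => exists N, C = syzn n N)); last by exists M.
  (* The syzygies are regrouped with the [n] outermost ones on the outside, as in the bound on
     [I]. *)
  move=> C I j [N ->] injI; rewrite syzn_add addnC -syzn_add.
  exact/tor1_zeroC/hn.
move=> C [N ->]; have [E [i [injE iI]]] := enough_injectives N.
have [D [p [pS e]]] := cokernel_exists i.
have sip : ses i p by [].
have [L [a [c [sac fL]]]] := horseshoe_iter sip (hn _ injE).
by exists L, (syzn n D), a, c; split=> //; exists D.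
Qed.

Lemma gflat_resolution0 M : gorenstein_flat M -> gflat_resolution M 0.
Proof.
move=> gM; have idL : linear (@id M) by [].
exists (fun n => if n is 0%N then M else zero_module),
  (fun n => zero_map zero_module (if n is 0%N then M else zero_module)), (mk_linear idL).
split.
- by case.
- by case=> // n _ x; exact: zero_moduleE.
- by move=> n x; split=> _ //; exists 0; exact: zero_moduleE.
- move=> x; split=> [|[y <-]] //; rewrite mk_linearE => ->.
  by exists 0.
- by move=> x; exists x.
Qed.

Lemma gflat_resolutionS k K P M (j : {linear K -> P}) (q : {linear P -> M}) :
  ses j q -> gorenstein_flat P -> gflat_resolution K k -> gflat_resolution M k.+1.
Proof.
move=> sjq gP [G [d [e [gG zG ed ee eS]]]]; have [jI eq qS] := sjq.
pose G' n := if n is n'.+1 then G n' else P.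
pose d' n : {linear G' n.+1 -> G' n} :=
  match n return {linear G' n.+1 -> G' n} with
  | 0%N => j \o e
  | n'.+1 => d n'
  end.
exists G', d', q; split=> //.
- by case=> [|n] // nk; exact: gG.
- by case=> [|n] // nk; exact: zG.
- by case=> [|n] //=; exact: splice_exact.
- exact: ses_exact_comp.
Qed.

Lemma gflat_resolution_syzn n M : gorenstein_flat (syzn n M) -> gflat_resolution M n.
Proof.
elim: n M => [|n IH] M; first exact: gflat_resolution0.
rewrite syznSr => /IH; apply: gflat_resolutionS; first exact: syz_ses.
exact/bflat_gorenstein_flat/free_bflat.
Qed.

(** A flat resolution of [G] that stays exact in positive degrees after tensoring with [I]; the last
    clause is the criterion of [tensor_exactP]. *)
Definition tensor_exact_resolution I G : Prop :=
  exists (F : nat -> lmodType R) (d : forall n, {linear F n.+1 -> F n})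
    (e : {linear F 0%N -> G}),
    [/\ forall n, bflat (F n), surj e, exact_at (d 0%N) e,
        forall n, exact_at (d n.+1) (d n)
      & forall n (b : F n.+1 -> I -> QZ), balanced b ->
          (forall x y, b (d n.+1 x) y = 0) ->
          exists c : F n -> I -> QZ, balanced c /\ forall x y, c (d n x) y = b x y].

(** Truncation gives such a resolution of the kernel of [e], which drives the induction on [j]. For
    [j = 0], a character on that kernel is pulled back to [F 1] and factors through [F 0] by tensor
    exactness. *)
Lemma tensor_exact_resolution_tor I G j : tensor_exact_resolution I G ->
  tor1_zero G (syzn j I).
Proof.
elim: j G => [|j IH] G [F [d [e [fF eS ee ed hb]]]]; have sK := kernel_ses eS;
  have [|f fE] := @factor_inj _ _ _ _ (kernel_inc e) (d 0%N) (@kernel_inc_inj _ _ _ e).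
- by move=> x; apply/kernel_incP/ee; exists x.
- apply: (tor1_zero_from sK); first exact: tor1_zero_bflat.
  move=> b bb; have bf := balanced_compl f bb.
  have [|c [bc cE]] := hb _ _ bf.
    move=> x y; rewrite (_ : f _ = 0) ?balanced0l //.
    apply: (@kernel_inc_inj _ _ _ e); rewrite fE linear0.
    by apply/ed; exists x.
  exists c; split=> // a y.
  have [|x xE] := (ee (kernel_inc e a)).1; first exact: kernel_incK.
  by rewrite -xE cE; congr b; apply: (@kernel_inc_inj _ _ _ e); rewrite fE.
- by move=> x; apply/kernel_incP/ee; exists x.
- apply: (tor1_zero_quot sK (syz_ses (syzn j I))); first exact: free_bflat.
    apply: IH; exists (fun n => F n.+1), (fun n => d n.+1), f; split=> //.
    + move=> x; have [|y yE] := (ee (kernel_inc e x)).1; first exact: kernel_incK.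
      by exists y; apply: (@kernel_inc_inj _ _ _ e); rewrite fE.
    + move=> x; rewrite -(ed 0%N x) -fE; split=> [->|E]; first by rewrite linear0.
      by apply: (@kernel_inc_inj _ _ _ e); rewrite E linear0.
    + by move=> n; exact: hb.
  exact/tor1_zero_bflat/fF.
Qed.

(** The left half of a complete resolution is a tensor-exact resolution, with [dmid F] corestricted
    to [G] as augmentation. *)
Lemma gorenstein_flat_tor G I j : gorenstein_flat G -> injective_module I ->
  tor1_zero G (syzn j I).
Proof.
move=> [F [[flo fup] [exl exl0 exu0 exu] [i [iI iim]] tex]] injI.
apply: tensor_exact_resolution_tor.
have [|e eE] := @factor_inj _ _ _ _ i (dmid F) iI.
  by move=> a; apply/iim; exists a.
have [texl texl0 _ _] := tex _ injI.
exists (lower F), (dlower F), e; split.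
- by move=> n; exact/flatP.
- by move=> x; have [z zE] := (iim (i x)).1 (ex_intro _ x erefl);
    exists z; apply: iI; rewrite eE.
- move=> x; rewrite -(exl0 x) -eE; split=> [->|E]; first by rewrite linear0.
  by apply: iI; rewrite E linear0.
- exact: exl.
- move=> n; have [|h _] := @tensor_exactP _ I _ _ _ (dlower F n.+1) (dlower F n).
    by move=> a; apply/exl; exists a.
  exact: (h (texl n)).
Qed.

Lemma gflat_resolution_tor k j N I : gflat_resolution N k -> injective_module I ->
  (k <= j)%N -> tor1_zero N (syzn j I).
Proof.
move=> rN injI; elim: k j N rN => [|k IH] j N [G [d [e [gG zG ed ee eS]]]] kj;
  have sK := kernel_ses eS.
  (* For [k = 0] the kernel of [e] is the image of [G 1], which is zero, so the zero map extends
     [b]. *)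
  apply: (tor1_zero_from sK); first by apply: gorenstein_flat_tor => //; exact: gG.
  move=> b bb; exists (fun _ _ => 0); split; first exact: balanced_zero.
  move=> a y; rewrite (_ : a = 0) ?balanced0l //.
  apply: (@kernel_inc_inj _ _ _ e); rewrite linear0.
  have [|x <-] := (ee (kernel_inc e a)).1; first exact: kernel_incK.
  by rewrite (zG 1%N isT x) linear0.
case: j kj => // j kj.
apply: (tor1_zero_quot sK (syz_ses (syzn j I))); first exact: free_bflat.
  apply: (IH j _ _ kj).
  have [|f fE] := @factor_inj _ _ _ _ (kernel_inc e) (d 0%N) (@kernel_inc_inj _ _ _ e).
    by move=> x; apply/kernel_incP/ee; exists x.
  exists (fun n => G n.+1), (fun n => d n.+1), f; split.
  - by move=> n nk; exact: gG.
  - by move=> n nk; exact: zG.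
  - by move=> n; exact: ed.
  - move=> x; rewrite -(ed 0%N x) -fE; split=> [->|E]; first by rewrite linear0.
    by apply: (@kernel_inc_inj _ _ _ e); rewrite E linear0.
  - move=> x; have [|y yE] := (ee (kernel_inc e x)).1; first exact: kernel_incK.
    by exists y; apply: (@kernel_inc_inj _ _ _ e); rewrite fE.
exact: (gorenstein_flat_tor (j := j.+1) (gG 0%N isT) injI).
Qed.

Lemma gflat_resolutions_le n :
  (forall M, exists2 k, (k <= n)%N & gflat_resolution M k) <-> injectives_fd_le R n.
Proof.
split=> [h I injI N|h M].
  have [k kn rN] := h N; apply/tor1_zero_syzn/tor1_zeroC.
  exact: gflat_resolution_tor rN injI kn.
by exists n => //; exact/gflat_resolution_syzn/syzn_gorenstein_flat.
Qed.

End GorensteinFlat.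

(** * Modules over a polynomial ring *)

Section Restriction.
Variables (R : comNzRingType) (W : lmodType {poly R}).

Definition restr : Type := W.

HB.instance Definition _ := GRing.Zmodule.on restr.

Definition restr_scale (a : R) (w : restr) : restr := a%:P *: (w : W).

Lemma restr_scaleA a b w : restr_scale a (restr_scale b w) = restr_scale (a * b) w.
Proof. by rewrite /restr_scale scalerA polyCM. Qed.

Lemma restr_scale1 : left_id 1 restr_scale.
Proof. by move=> w; rewrite /restr_scale scale1r. Qed.

Lemma restr_scaleDr : right_distributive restr_scale +%R.
Proof. by move=> a v w; rewrite /restr_scale scalerDr. Qed.

Lemma restr_scaleDl w : {morph restr_scale^~ w : a b / a + b}.
Proof. by move=> a b; rewrite /restr_scale polyCD scalerDl. Qed.

HB.instance Definition _ := GRing.Zmodule_isLmodule.Build R restr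
  restr_scaleA restr_scale1 restr_scaleDr restr_scaleDl.

Lemma restr_scaleE a (w : restr) : a *: w = a%:P *: (w : W).
Proof. by []. Qed.

End Restriction.

Section PolyModule.
Variables (R : comNzRingType) (V : lmodType R) (phi : {linear V -> V}).

(** The polynomial [p] evaluated at the endomorphism [phi]. *)
Definition poly_act (p : {poly R}) (v : V) : V :=
  \sum_(i < size p) p`_i *: iter i phi v.

Lemma iter_linear n : linear (iter n phi).
Proof. by elim: n => [|n IH] a u v //=; rewrite IH linearP. Qed.

Lemma poly_act_widen n (p : {poly R}) v : (size p <= n)%N ->
  poly_act p v = \sum_(i < n) p`_i *: iter i phi v.
Proof.
move=> pn; rewrite /poly_act (big_ord_widen n (fun i => p`_i *: iter i phi v)) //.
rewrite big_mkcond; apply: eq_bigr => i _.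
by case: ltnP => // ip; rewrite nth_default ?scale0r.
Qed.

Lemma poly_actDl v : {morph poly_act^~ v : p q / p + q}.
Proof.
move=> p q; pose n := maxn (size p) (size q).
rewrite (@poly_act_widen n (p + q)) ?size_polyD // (@poly_act_widen n p) ?leq_maxl //.
rewrite (@poly_act_widen n q) ?leq_maxr // -big_split; apply: eq_bigr => i _ /=.
by rewrite coefD scalerDl.
Qed.

Lemma poly_actP p : linear (poly_act p).
Proof.
move=> a u v; rewrite /poly_act scaler_sumr -big_split; apply: eq_bigr => i _ /=.
by rewrite iter_linear scalerDr !scalerA mulrC.
Qed.

Lemma poly_actC c v : poly_act c%:P v = c *: v.
Proof.
by rewrite (@poly_act_widen 1) ?size_polyC ?leq_b1 // big_ord1 coefC.
Qed.

Lemma poly_actMX p v : poly_act (p * 'X) v = poly_act p (phi v).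
Proof.
rewrite (@poly_act_widen (size p).+1); last first.
  by rewrite (leq_trans (size_polyMleq _ _)) // size_polyX addn2.
rewrite big_ord_recl coefMX scale0r add0r; apply: eq_bigr => i _.
by rewrite coefMX /= -iterS iterSr.
Qed.

Lemma poly_act_phi p v : phi (poly_act p v) = poly_act p (phi v).
Proof.
rewrite /poly_act linear_sum; apply: eq_bigr => i _ /=.
by rewrite linearZ /= -iterS iterSr.
Qed.

Lemma poly_actM p q v : poly_act p (poly_act q v) = poly_act (p * q) v.
Proof.
elim/poly_ind: p v => [|p c IH] v.
  by rewrite mul0r -polyC0 !poly_actC !scale0r.
rewrite poly_actDl poly_actMX poly_act_phi IH poly_actC -poly_actMX.
rewrite mulrDl poly_actDl -!mulrA ['X * q]mulrC; congr (_ + _).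
rewrite (@poly_act_widen (size q) (c%:P * q)); last first.
  by rewrite mul_polyC size_scale_leq.
rewrite /poly_act scaler_sumr; apply: eq_bigr => i _.
by rewrite scalerA coefCM.
Qed.

Lemma poly_act1 : left_id 1 poly_act.
Proof. by move=> v; rewrite -[1]/(1%:P) poly_actC scale1r. Qed.

Lemma poly_actDr : right_distributive poly_act +%R.
Proof. by move=> p u v; rewrite -[u in LHS]scale1r poly_actP scale1r. Qed.

End PolyModule.

(** The indeterminate acts as the phantom parameter [phi]. *)
Definition polymod (R : comNzRingType) (V : lmodType R) (phi : {linear V -> V}) : Type := V.

Section PolyModuleInstance.
Variables (R : comNzRingType) (V : lmodType R) (phi : {linear V -> V}).

HB.instance Definition _ := GRing.Zmodule.on (polymod phi).
HB.instance Definition _ := GRing.Zmodule_isLmodule.Build {poly R} (polymod phi)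
  (@poly_actM R V phi) (@poly_act1 R V phi) (@poly_actDr R V phi) (@poly_actDl R V phi).

Lemma polymodC c (v : polymod phi) : c%:P *: v = c *: (v : V).
Proof. exact: (poly_actC phi c v). Qed.

Lemma polymodX (v : polymod phi) : 'X *: v = phi v.
Proof.
rewrite -['X]mul1r; rewrite -[LHS]/(poly_act phi (1 * 'X) v).
by rewrite poly_actMX; exact: (poly_act1 phi (phi v)).
Qed.

End PolyModuleInstance.

Section PolyLinear.
Variable R : comNzRingType.
Implicit Types A B C V W : lmodType {poly R}.

(** Horner induction on the scalar: constants and the indeterminate generate the ring. *)
Lemma poly_linear V W (f : V -> W) : zmod_morphism f ->
  (forall c v, f (c%:P *: v) = c%:P *: f v) -> (forall v, f ('X *: v) = 'X *: f v) ->
  linear f.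
Proof.
move=> fB fC fX p u v; rewrite (zmod_morphismD fB); congr (_ + _).
elim/poly_ind: p u => [|p c IH] u; first by rewrite !scale0r (zmod_morphism0 fB).
by rewrite !scalerDl (zmod_morphismD fB) fC -!scalerA IH fX.
Qed.

Lemma poly_balanced V W (b : V -> W -> QZ) :
  (forall w, zmod_morphism (b^~ w)) -> (forall v, zmod_morphism (b v)) ->
  (forall c v w, b (c%:P *: v) w = b v (c%:P *: w)) ->
  (forall v w, b ('X *: v) w = b v ('X *: w)) -> balanced b.
Proof.
move=> bl br bC bX; split=> // p v w.
elim/poly_ind: p v w => [|p c IH] v w.
  by rewrite !scale0r (zmod_morphism0 (bl w)) (zmod_morphism0 (br v)).
rewrite !scalerDl (zmod_morphismD (bl w)) (zmod_morphismD (br v)) bC.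
by rewrite -!scalerA IH bX !scalerA mulrC.
Qed.

Lemma restr_linear V W (f : {linear V -> W}) : linear (f : restr V -> restr W).
Proof. by move=> a u v; rewrite !restr_scaleE linearP. Qed.

Definition restr_map V W (f : {linear V -> W}) : {linear restr V -> restr W} :=
  mk_linear (restr_linear f).

Lemma restr_ses A B C (i : {linear A -> B}) (p : {linear B -> C}) :
  ses i p -> ses (restr_map i) (restr_map p).
Proof. by case=> iI e pS; split. Qed.

Lemma restr_balanced V W (b : V -> W -> QZ) :
  balanced b -> @balanced R (restr V) (restr W) b.
Proof. by case=> bl br bz; split=> // a v w; rewrite !restr_scaleE bz. Qed.

End PolyLinear.

Section PolymodMap.
Variable R : comNzRingType.
Implicit Types U V W : lmodType R.

Lemma polymod_linear V W (phi : {linear V -> V}) (psi : {linear W -> W})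
    (f : {linear V -> W}) :
  (forall v, f (phi v) = psi (f v)) -> linear (f : polymod phi -> polymod psi).
Proof.
move=> h; apply: poly_linear => [u v|c v|v].
- exact: linearB.
- by rewrite !polymodC linearZ.
- by rewrite !polymodX.
Qed.

Lemma to_restr_linear V (phi : {linear V -> V}) : linear (id : V -> restr (polymod phi)).
Proof. by move=> a u v; rewrite restr_scaleE polymodC. Qed.

Lemma of_restr_linear V (phi : {linear V -> V}) : linear (id : restr (polymod phi) -> V).
Proof. by move=> a u v; rewrite restr_scaleE polymodC. Qed.

(** The identity on the carrier; the two [R]-structures agree only propositionally. *)
Definition to_restr V phi : {linear V -> restr (polymod phi)} :=
  mk_linear (@to_restr_linear V phi).
Definition of_restr V phi : {linear restr (polymod phi) -> V} :=
  mk_linear (@of_restr_linear V phi).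

Lemma restr_polymod_bflat V (phi : {linear V -> V}) : bflat V -> bflat (restr (polymod phi)).
Proof.
move=> fV A B i iI b bb.
have [c [bc cE]] := fV _ _ _ iI _ (balanced_compr (to_restr phi) bb).
exists (fun x v => c x (of_restr phi v)); split; first exact: balanced_compr.
by move=> a v; rewrite cE.
Qed.

(** [V] as a module over [R[X]/(X)]. *)
Definition trivmod V : lmodType {poly R} := polymod (zero_map V V).

Lemma trivmodX V (v : trivmod V) : 'X *: v = 0.
Proof. by rewrite polymodX. Qed.

Lemma trivmod_linear V W (f : {linear V -> W}) : linear (f : trivmod V -> trivmod W).
Proof. by apply: polymod_linear => v; rewrite !mk_linearE linear0. Qed.

Definition trivmod_map V W (f : {linear V -> W}) : {linear trivmod V -> trivmod W} :=
  mk_linear (trivmod_linear f).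

Lemma trivmod_ses U V W (i : {linear U -> V}) (p : {linear V -> W}) :
  ses i p -> ses (trivmod_map i) (trivmod_map p).
Proof. by case=> iI e pS; split. Qed.

Lemma trivmod_balanced V W (b : V -> W -> QZ) :
  balanced b -> @balanced {poly R} (trivmod V) (trivmod W) b.
Proof.
move=> bb; have [bl br bz] := bb; apply: poly_balanced => // [c v w|v w].
  by rewrite !polymodC bz.
by rewrite !trivmodX (balanced0l _ bb) (balanced0r _ bb).
Qed.

End PolymodMap.

(** * Extension of scalars to the polynomial ring *)

Section PolyExtension.
Variable R : comNzRingType.
Implicit Types A B M : lmodType R.
Implicit Types W Y E : lmodType {poly R}.

Lemma dsum_shift_exists A : exists s : {linear dsum nat A -> dsum nat A},
  forall n a, s (dsum_delta n a) = dsum_delta n.+1 a.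
Proof. by have [s sE] := dsum_lift (fun n => @dsum_delta R nat A n.+1); exists s. Qed.

Definition dsum_shift A := projT1 (cid (dsum_shift_exists A)).

Lemma dsum_shiftE A n a : dsum_shift A (dsum_delta n a) = dsum_delta n.+1 a.
Proof. by rewrite /dsum_shift; case: cid. Qed.

(** [A[X]] is sealed behind this interface: unfolding its construction makes
    unification very slow. *)
Record poly_extension A := PolyExtension {
  pe_mod : lmodType {poly R};
  pe_mono : nat -> A -> pe_mod;
  pe_coord : nat -> pe_mod -> A;
  pe_monoB : forall n, zmod_morphism (pe_mono n);
  pe_monoC : forall n c a, c%:P *: pe_mono n a = pe_mono n (c *: a);
  pe_monoX : forall n a, 'X *: pe_mono n a = pe_mono n.+1 a;
  pe_coordB : forall n, zmod_morphism (pe_coord n);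
  pe_coordC : forall n c p, pe_coord n (c%:P *: p) = c *: pe_coord n p;
  pe_coord_mono : forall m n a, pe_coord m (pe_mono n a) = if m == n then a else 0;
  pe_coord_eq : forall p q, (forall n, pe_coord n p = pe_coord n q) -> p = q;
  pe_ext : forall (Z : zmodType) (f g : pe_mod -> Z),
    zmod_morphism f -> zmod_morphism g ->
    (forall n a, f (pe_mono n a) = g (pe_mono n a)) -> f =1 g;
  pe_fold : forall (Z : zmodType) (c : nat -> A -> Z), (forall n, zmod_morphism (c n)) ->
    exists f : pe_mod -> Z, zmod_morphism f /\ forall n a, f (pe_mono n a) = c n a
}.

Lemma poly_extension_exists A : exists _ : poly_extension A, True.
Proof.
unshelve eexists (@PolyExtension A (polymod (dsum_shift A)) (@dsum_delta R nat A)
  (@dsum_coord R nat A) _ _ _ _ _ _ _ _ _) => //.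
- by move=> n a b; exact: linearB.
- by move=> n c a; rewrite polymodC linearZ.
- by move=> n a; rewrite polymodX dsum_shiftE.
- by move=> n c p; rewrite polymodC; exact: (linearZ_LR (@dsum_coord R nat A n)).
- by move=> m n a; exact: dsum_deltaE.
- exact: dsum_eq.
- by move=> Z f g; exact: dsum_ext.
- move=> Z c cB; exists (dsum_fold c); split; first exact: dsum_fold_zmod_morphism.
  exact: dsum_fold_delta.
Qed.

Definition the_poly_extension A : poly_extension A :=
  projT1 (cid (poly_extension_exists A)).

(** [A[X]], that is, [R[X] (x) A]. *)
Definition polyext A : lmodType {poly R} := pe_mod (the_poly_extension A).

Definition mono A (n : nat) (a : A) : polyext A := pe_mono _ n a.

Definition pcoord A (n : nat) (p : polyext A) : A := pe_coord n p.

Lemma monoX A n (a : A) : 'X *: mono n a = mono n.+1 a.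
Proof. exact: pe_monoX. Qed.

Lemma monoXn A m n (a : A) : 'X^m *: mono n a = mono (m + n) a.
Proof.
elim: m => [|m IH]; first by rewrite expr0 scale1r.
by rewrite exprS -scalerA IH monoX.
Qed.

Lemma monoB A n (a b : A) : mono n (a - b) = mono n a - mono n b.
Proof. exact: pe_monoB. Qed.

Lemma monoD A n (a b : A) : mono n (a + b) = mono n a + mono n b.
Proof. exact: (zmod_morphismD (@monoB A n)). Qed.

Lemma mono0r A n : mono n (0 : A) = 0.
Proof. exact: (zmod_morphism0 (@monoB A n)). Qed.

Lemma monoC A n c (a : A) : c%:P *: mono n a = mono n (c *: a).
Proof. exact: pe_monoC. Qed.

Lemma pcoordB A n : zmod_morphism (@pcoord A n).
Proof. exact: pe_coordB. Qed.

Lemma pcoordC A n c (p : polyext A) : pcoord n (c%:P *: p) = c *: pcoord n p.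
Proof. exact: pe_coordC. Qed.

Lemma pcoord_mono A m n (a : A) : pcoord m (mono n a) = if m == n then a else 0.
Proof. exact: pe_coord_mono. Qed.

Lemma pcoord_eq A (p q : polyext A) : (forall n, pcoord n p = pcoord n q) -> p = q.
Proof. exact: pe_coord_eq. Qed.

Lemma mono_linear A n : linear (mono n : A -> restr (polyext A)).
Proof. by move=> c a b; rewrite restr_scaleE monoC -monoD. Qed.

Definition mono_map A n : {linear A -> restr (polyext A)} := mk_linear (@mono_linear A n).

Definition mono0 A := mono_map A 0.

Lemma polyext_ext A (Z : zmodType) (f g : polyext A -> Z) :
  zmod_morphism f -> zmod_morphism g ->
  (forall n a, f (mono n a) = g (mono n a)) -> f =1 g.
Proof. exact: pe_ext. Qed.

Lemma polyext_fold A (Z : zmodType) (c : nat -> A -> Z) : (forall n, zmod_morphism (c n)) ->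
  exists f : polyext A -> Z, zmod_morphism f /\ forall n a, f (mono n a) = c n a.
Proof. exact: pe_fold. Qed.

Lemma polyext_lift A W (f : {linear A -> restr W}) :
  exists g : {linear polyext A -> W}, forall n a, g (mono n a) = 'X^n *: (f a : W).
Proof.
pose c n a : W := 'X^n *: (f a : W).
have cB n : zmod_morphism (c n) by move=> a b; rewrite /c linearB -scalerBr.
have [g0 [gB gE]] := polyext_fold cB.
have gL : linear g0.
  apply: poly_linear => // [r p|p].
    apply: (@polyext_ext A W (fun p => g0 (r%:P *: p))
      (fun p => r%:P *: g0 p)) => [x y|x y|n a].
    - by rewrite scalerBr gB.
    - by rewrite gB scalerBr.
    - by rewrite monoC !gE /c linearZ /= restr_scaleE !scalerA mulrC.
  apply: (@polyext_ext A W (fun p => g0 ('X *: p))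
    (fun p => 'X *: g0 p)) => [x y|x y|n a].
  - by rewrite scalerBr gB.
  - by rewrite gB scalerBr.
  - by rewrite monoX !gE /c scalerA exprS.
by exists (mk_linear gL) => n a; rewrite mk_linearE gE.
Qed.

(** Base change: tensoring [A[X]] with [W] over [R[X]] is tensoring [A] with [W] over [R]. *)
Lemma polyext_balanced A W (b : A -> restr W -> QZ) : balanced b ->
  exists c : polyext A -> W -> QZ, balanced c /\
    forall n a w, c (mono n a) w = b a ('X^n *: w).
Proof.
case=> bl br bz; pose k n w a : QZ := b a ('X^n *: w : W).
have kB w n : zmod_morphism (k n w) by move=> x y; exact: bl.
pose c p w := projT1 (cid (polyext_fold (kB w))) p.
have [cB cE] : (forall w, zmod_morphism (c^~ w)) /\
    forall n a w, c (mono n a) w = b a ('X^n *: w).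
  by split=> [w|n a w]; rewrite /c; case: cid => f [].
exists c; split=> //; apply: poly_balanced => // [p w w'|r p w|p w].
- move: p; apply: (@polyext_ext A _ (c^~ (w - w')) (fun p => c p w - c p w'))
    => [//|x y|n a]; first by rewrite !cB !opprD !opprK addrACA.
  by rewrite !cE scalerBr br.
- apply: (@polyext_ext A _ (fun p => c (r%:P *: p) w) (c^~ (r%:P *: w)))
    => [x y||n a]; rewrite ?scalerBr ?cB //.
  rewrite monoC !cE bz restr_scaleE; congr b.
  by rewrite !scalerA mulrC.
- apply: (@polyext_ext A _ (fun p => c ('X *: p) w) (c^~ ('X *: w)))
    => [x y||n a]; rewrite ?scalerBr ?cB //.
  by rewrite monoX !cE scalerA exprSr.
Qed.

Lemma polyext_map_inj A B (i : {linear A -> B}) : injective i ->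
  exists f : {linear polyext A -> polyext B}, injective f /\
    forall n a, f (mono n a) = mono n (i a).
Proof.
move=> iI; have [f fE] := polyext_lift (mono0 B \o i).
have fE' n a : f (mono n a) = mono n (i a) by rewrite fE /= monoXn addn0.
exists f; split=> // p q pq; apply: pcoord_eq => n; apply: iI.
have fc r : pcoord n (f r) = i (pcoord n r).
  apply: (@polyext_ext A B (fun r => pcoord n (f r)) (fun r => i (pcoord n r)))
    => [x y|x y|m a].
  - by rewrite linearB pcoordB.
  - by rewrite pcoordB linearB.
  - by rewrite fE' !pcoord_mono; case: eqP => // _; rewrite linear0.
by rewrite -!fc pq.
Qed.

(** Restriction is right adjoint to [polyext], which preserves injections. *)
Lemma restr_injective E : injective_module E -> injective_module (restr E).
Proof.
move=> injE A B i f iI; have [j [jI jE]] := polyext_map_inj iI.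
have [g gE] := polyext_lift f; have [h hE] := injE _ _ j g jI.
exists (restr_map h \o mono0 B) => a /=.
by rewrite -jE hE gE expr0 scale1r.
Qed.

Lemma restr_bflat W : bflat W -> bflat (restr W).
Proof.
move=> fW A B i iI b bb; have [j [jI jE]] := polyext_map_inj iI.
have [c [bc cE]] := polyext_balanced bb; have [d [bd dE]] := fW _ _ _ jI _ bc.
exists (fun x w => d (mono0 B x) w); split.
  exact: balanced_compl (restr_balanced bd).
by move=> a w; rewrite mk_linearE -jE dE cE expr0 scale1r.
Qed.

(** By base change a balanced map is determined on constants [M]; it is extended there over [R] and
    then spread to all monomials. *)
Lemma polyext_tor1_zero Y M : tor1_zero (restr Y) M -> tor1_zero Y (polyext M).
Proof.
move=> tYM A B i p sip b bb.
have [|c [bc cE]] := tYM _ _ _ _ (restr_ses sip) (fun a m => b a (mono0 M m)).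
  exact: balanced_compr (restr_balanced bb).
have [d [/balancedC bd dE]] := polyext_balanced (balancedC bc).
exists (fun x w => d w x); split=> // a w; have [_ br bz] := bb.
move: w; apply: polyext_ext => [x y||n m].
- by case: bd => _ dr _; exact: dr.
- exact: br.
by rewrite dE -linearZ cE bz /= monoXn addn0.
Qed.

Lemma polyext_bflat M : bflat M -> bflat (polyext M).
Proof.
by move=> fM; apply/bflatP => C; apply: polyext_tor1_zero; exact: bflat_tor1_zero.
Qed.

(** A free [R[X]]-module is flat over [R], so restricting a syzygy sequence still permits dimension
    shifting, even though its kernel is not the chosen [syz] over [R]. *)
Lemma fd_le_restr_syzn n M Y : fd_le n M -> tor1_zero M (restr (syzn n Y)).
Proof.
elim: n M => [|n IH] M fM; first exact/tor1_zero_bflat/fd_le0.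
apply: (tor1_zero_quot (syz_ses M) (restr_ses (syz_ses (syzn n Y)))).
- exact/restr_bflat/free_bflat.
- exact/IH/fd_le_syz.
- exact/tor1_zero_bflat/free_bflat.
Qed.

Lemma polyext_fd_le n M : fd_le n M -> fd_le n (polyext M).
Proof. by move=> fM Y; exact/tor1_zeroC/polyext_tor1_zero/tor1_zeroC/fd_le_restr_syzn. Qed.

(** The characteristic sequence [0 -> W[X] -> W[X] -> W -> 0]; the map [s] below
    is a contracting homotopy over [R]. *)
Lemma char_ses W : exists (d : {linear polyext (restr W) -> polyext (restr W)})
  (e : {linear polyext (restr W) -> W}), ses d e.
Proof.
have dL : linear (fun w : restr W =>
    (mono 1 w - mono 0 ('X *: (w : W) : restr W) : restr (polyext (restr W)))).
  move=> a u v.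
  rewrite [X in _ = X + _]restr_scaleE scalerBr !monoC !monoD [in 'X *: _]scalerDr monoD opprD.
  have -> : 'X *: (a *: u : restr W) = a *: ('X *: (u : W) : restr W) :> W.
    by rewrite !restr_scaleE !scalerA mulrC.
  by rewrite addrACA.
have [d dE'] := polyext_lift (mk_linear dL).
have dE n w : d (mono n w) = mono n.+1 w - mono n ('X *: (w : W) : restr W).
  by rewrite dE' mk_linearE scalerBr !monoXn addn1 addn0.
have idL : linear (id : restr W -> restr W) by [].
have [e eE'] := polyext_lift (mk_linear idL).
have eE n w : e (mono n w) = 'X^n *: (w : W) by rewrite eE'.
(* With T the variable of [W[X]] and X the action on [W], [d] is multiplication by T - X, and [S n]
   is the quotient of T^n - X^n by T - X, a telescoping sum. *)
pose S := fix S (n : nat) (w : restr W) : polyext (restr W) :=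
  if n is n'.+1 then mono n' w + S n' ('X *: (w : W)) else 0.
have SB n : zmod_morphism (S n).
  elim: n => [|n IH] u v /=; first by rewrite subrr.
  by rewrite scalerBr IH monoB opprD addrACA.
pose s (p : polyext (restr W)) : polyext (restr W) := projT1 (cid (polyext_fold SB)) p.
have [sB sE] : zmod_morphism s /\ forall n w, s (mono n w) = S n w.
  by rewrite /s; case: cid.
have sd p : s (d p) = p.
  apply: (@polyext_ext _ _ (s \o d) id) p => [x y|//|n w] /=.
    by rewrite linearB sB.
  by rewrite dE sB !sE /= addrK.
have ds p : d (s p) = p - mono 0 (e p : restr W).
  apply: (@polyext_ext _ _ (d \o s) (fun p => p - mono 0 (e p : restr W))) p
    => [x y|x y|n w] /=.
  - by rewrite sB linearB.
  - by rewrite linearB monoB !opprD !opprK addrACA.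
  rewrite sE eE; elim: n w => [|n IH] w /=.
    by rewrite linear0 expr0 scale1r subrr.
  by rewrite linearD dE IH scalerA -exprSr addrA subrK.
exists d, e; split; first exact: can_inj sd.
  move=> p; split=> [ep|[q <-]].
    by exists (s p); rewrite ds ep mono0r subr0.
  apply: (@polyext_ext _ _ (e \o d) (fun=> 0)) q => [x y|x y|n w] /=.
  - by rewrite !linearB.
  - by rewrite subr0.
  - by rewrite dE linearB !eE scalerA -exprSr subrr.
by move=> w; exists (mono 0 (w : restr W)); rewrite eE expr0 scale1r.
Qed.

Lemma restr_fd_le n W : fd_le n (restr W) -> fd_le n.+1 W.
Proof.
move=> fW; have [d [e sde]] := char_ses W; have fX := polyext_fd_le fW.
exact: fd_le_quot sde fX (fd_le_leq (leqnSn n) fX).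
Qed.

Lemma injectives_fd_le_poly n : injectives_fd_le R n -> injectives_fd_le {poly R} n.+1.
Proof. by move=> h E injE; exact/restr_fd_le/h/restr_injective. Qed.

End PolyExtension.

(** * Descent from the polynomial ring *)

Section Descent.
Variable R : comNzRingType.
Implicit Types A B M I : lmodType R.

Section Coinduced.
Variable I : lmodType R.

Lemma shiftl_linear : linear (fun (h : nat -> I) n => h n.+1).
Proof. by []. Qed.

(** A map out of [R[X]] is recorded by its values on the powers of the indeterminate, which then
    acts by shifting. *)
Definition shiftl : {linear (nat -> I) -> (nat -> I)} := mk_linear shiftl_linear.

(** [Hom_R(R[X], I)]. *)
Definition coind : lmodType {poly R} := polymod shiftl.

Definition coind_val (h : coind) (n : nat) : I := h n.

Lemma coind_valX h n : coind_val ('X *: h) n = coind_val h n.+1.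
Proof. by rewrite polymodX. Qed.

Lemma coind_valXn h n : coind_val ('X^n *: h) 0 = coind_val h n.
Proof.
elim: n h => [|n IH] h; first by rewrite expr0 scale1r.
by rewrite exprSr -scalerA IH coind_valX.
Qed.

Lemma coind_eq h k : coind_val h =1 coind_val k -> h = k.
Proof. by move=> E; apply/funext. Qed.

(** Coinduction is right adjoint to restriction: coordinate 0 is extended over [R], and coordinate
    [n] is coordinate 0 after multiplication by ['X^n]. *)
Lemma coind_injective : injective_module I -> injective_module coind.
Proof.
move=> injI A B i f iI.
have f0L : linear (fun a : restr A => coind_val (f a) 0).
  by move=> r a b; rewrite restr_scaleE linearP polymodC.
have [g0 g0E] := injI _ _ (restr_map i) (mk_linear f0L) iI.
have gL : linear (fun b : B => (fun n => g0 ('X^n *: b : restr B)) : coind).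
  apply: poly_linear => [u v|c v|v]; apply: coind_eq => n; rewrite /coind_val.
  - by rewrite scalerBr linearB.
  - rewrite polymodC; have -> : 'X^n *: (c%:P *: v) = c *: ('X^n *: v : restr B).
      by rewrite restr_scaleE !scalerA mulrC.
    by rewrite linearZ.
  - by rewrite -/(coind_val _ n) coind_valX /coind_val scalerA -exprSr.
exists (mk_linear gL) => a; apply: coind_eq => n.
rewrite mk_linearE /coind_val -linearZ -[RHS]/(coind_val (f a) n) -coind_valXn.
by rewrite -linearZ; exact: g0E.
Qed.

Lemma coind_ses : exists (i : {linear trivmod I -> coind}) (p : {linear coind -> coind}),
  ses i p.
Proof.
have iL : linear (fun x : I => (fun n => if n is 0%N then x else 0) : nat -> I).
  by move=> r x y; apply/funext => -[|n] //; rewrite !fctE scaler0 addr0.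
have iPL : linear (mk_linear iL : trivmod I -> coind).
  by apply: polymod_linear => x; apply/funext => -[|n].
have pPL : linear (shiftl : coind -> coind) by exact: polymod_linear.
exists (mk_linear iPL), (mk_linear pPL); split.
- by move=> x y /(congr1 (fun h : nat -> I => h 0%N)).
- move=> h; split=> [ph|[x <-]]; last by apply/funext => -[|n].
  exists (coind_val h 0); apply: coind_eq => -[|n] //.
  by have := congr1 (fun k => coind_val k n) ph.
- by move=> h; exists (fun n => coind_val h n.-1).
Qed.

End Coinduced.

Lemma trivmod_injective_fd_le n I : injectives_fd_le {poly R} n ->
  injective_module I -> fd_le n (trivmod I).
Proof.
move=> h injI; have [i [p sip]] := coind_ses I.
have fE := h _ (coind_injective injI).
exact: fd_le_sub sip (fd_le_leq (leqnSn n) fE) fE.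
Qed.

(** With [F] free over [M] and [L] the kernel of [F[X] -> M], taking the linear
    coefficient maps [L] onto [M], where [X] acts as zero; flatness of [L] then
    passes to [M]. *)
Lemma bflat_of_trivmod M : fd_le 1 (trivmod M) -> bflat M.
Proof.
move=> fM; pose F := free M; pose pi : {linear F -> M} := free_proj M.
have piS : surj pi by exact: free_proj_surj.
have [th thE] := polyext_lift (to_restr (zero_map M M) \o pi).
have th0 p : th p = pi (pcoord 0%N p).
  apply: (@polyext_ext _ _ M th (fun p => pi (pcoord 0%N p))) p => [x y|x y|n f].
  - exact: linearB.
  - by rewrite pcoordB linearB.
  rewrite thE pcoord_mono; case: n => [|n]; first by rewrite expr0 scale1r.
  by rewrite exprS -scalerA trivmodX linear0.
have thS : surj th.
  by move=> m; have [f fE] := piS m; exists (mono 0 f); rewrite th0 pcoord_mono.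
have sL := kernel_ses thS; set L := kernel th in sL; set j := kernel_inc th in sL.
have fL : bflat L.
  by apply/fd_le0/(fd_le_sub sL fM)/bflat_fd_le/polyext_bflat/free_bflat.
have coordX p : pcoord 1%N ('X *: p : polyext F) = pcoord 0%N p.
  apply: (@polyext_ext _ _ F (fun p => pcoord 1%N ('X *: p : polyext F))
    (pcoord 0%N)) p => [x y|x y|n f].
  - by rewrite scalerBr pcoordB.
  - exact: pcoordB.
  - by rewrite monoX !pcoord_mono.
(* Multiplication by the indeterminate moves the constant coefficient of [l] to degree one, and [pi]
   kills it because [l] lies in the kernel of [th]. *)
have rhoL : linear (fun l : L => pi (pcoord 1%N (j l)) : trivmod M).
  apply: poly_linear => [x y|c l|l].
  - by rewrite linearB pcoordB linearB.
  - by rewrite linearZ_LR pcoordC polymodC linearZ.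
  - by rewrite linearZ trivmodX coordX -th0; exact: kernel_incK.
(* [la f] is the monomial of degree one with coefficient [f]; its linear coefficient has image
   [pi f]. *)
have [||la laE] := @factor_inj _ _ _ _ (restr_map j) (mono_map F 1).
- exact: kernel_inc_inj.
- move=> f; apply/kernel_incP; rewrite mk_linearE th0 pcoord_mono.
  exact: linear0.
move=> A B i iI b bb.
have [c [bc cE]] := fL _ _ (trivmod_map i) iI _
  (balanced_compr (mk_linear rhoL) (trivmod_balanced bb)).
have bcl := balanced_compl la
  (balancedC (balanced_compl (to_restr (zero_map B B)) (restr_balanced bc))).
(* If [pi f = 0], the constant [f] already lies in [L] and [la f] is ['X] times it; balancedness
   moves ['X] to [B], where it acts as zero. So [c] along [la] descends to [M]. *)
have [f x pf0|d [/balancedC bd dE]] := balanced_factor piS bcl.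
  have [|l lE] := (kernel_incP th (mono 0 f)).1; first by rewrite th0 pcoord_mono.
  have -> : la f = 'X *: l.
    apply: (@kernel_inc_inj _ _ _ th); rewrite linearZ_LR lE monoX.
    exact: laE.
  by have [_ _ bz] := bc; rewrite -bz trivmodX balanced0l.
exists (fun x m => d m x); split=> // a m; have [f <-] := piS m.
rewrite dE; have := cE a (la f) => ->; rewrite mk_linearE.
have -> : j (la f) = mono 1 f by exact: laE.
by rewrite pcoord_mono.
Qed.

(** Induction along syzygies over [R], which [trivmod] keeps exact; the bound for the free term
    comes from [restr_fd_le]. *)
Lemma fd_le_of_trivmod n M : fd_le n.+1 (trivmod M) -> fd_le n M.
Proof.
elim: n M => [|n IH] M fM; first exact/bflat_fd_le/bflat_of_trivmod.
apply/fd_le_syz/IH/(fd_le_sub (trivmod_ses (syz_ses M)) fM)/restr_fd_le.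
exact/bflat_fd_le/restr_polymod_bflat/free_bflat.
Qed.

Lemma injectives_fd_le_of_poly n : injectives_fd_le {poly R} n.+1 -> injectives_fd_le R n.
Proof. by move=> h I injI; exact/fd_le_of_trivmod/trivmod_injective_fd_le. Qed.

(** Multiplication by the indeterminate is injective on [R[X]] but zero on a nonzero [trivmod I],
    which therefore cannot be flat. *)
Lemma injectives_not_flat_poly : ~ injectives_fd_le {poly R} 0.
Proof.
move=> h; have [I [i [injI iI]]] := enough_injectives R^o.
have fI := fd_le0 (trivmod_injective_fd_le h injI).
pose x0 : I := i (1 : R^o).
have x0N : x0 <> 0 by rewrite -(linear0 i) => /iI /eqP; rewrite (negPf (oner_neq0 R)).
have [|chi [chiB _ chi0]] := @QZ_separate I (fun x => x = 0) x0 _ x0N.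
  by split=> // _ _ -> ->; rewrite subr0.
have XL : linear (fun p : {poly R}^o => p * 'X : {poly R}^o).
  by move=> c p q; rewrite mulrDl scalerAl.
have XI : injective (mk_linear XL).
  move=> p q E; apply/polyP => k; have := congr1 (fun r : {poly R} => r`_k.+1) E.
  by rewrite /= !coefMX.
(* An extension [c] of [b] along multiplication by ['X] would give
   [chi x0 = c 'X x0 = c 1 ('X *: x0) = 0]. *)
pose b (p : {poly R}^o) (x : trivmod I) : QZ := chi ((p : {poly R}) *: x).
have bb : balanced b.
  split=> [x p q|p x y|r p x]; rewrite /b.
  - by rewrite scalerBl chiB.
  - by rewrite scalerBr chiB.
  - by rewrite scalerA [r *: p]mulrC.
have [c [[_ br bz] cE]] := fI _ _ _ XI _ bb.
apply: chi0; have := cE (1 : {poly R}^o) x0; rewrite /b scale1r => <-.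
have -> : mk_linear XL 1 = 'X *: (1 : {poly R}^o).
  by rewrite mk_linearE mul1r [RHS]mulr1.
by rewrite bz trivmodX (zmod_morphism0 (br _)).
Qed.

End Descent.

(** * Comparison of dimensions through their finite upper bounds *)

Lemma least_le (P : nat -> Prop) n : (forall i j, (i <= j)%N -> P i -> P j) ->
  enat_le (least P) (Some n) <-> P n.
Proof.
move=> Pmono; rewrite /least; case: pselect => [exP|nP] /=.
  case: ex_minnP => m /asboolP Pm mmin; split=> [mn|Pn]; first exact: Pmono Pm.
  exact/mmin/asboolP.
by split=> // Pn; apply: nP; exists n; apply/asboolP.
Qed.

Lemma enat_eq (x y : option nat) :
  (forall n, enat_le x (Some n) <-> enat_le y (Some n)) -> x = y.
Proof.
case: x y => [m|] [k|] h //=; last 2 first.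
- by have := (h m).1 (leqnn m).
- by have := (h k).2 (leqnn k).
congr Some; apply/eqP; rewrite eqn_leq.
by rewrite [(m <= k)%N](h k).2 ?[(k <= m)%N](h m).1 //=.
Qed.

Lemma enat_le_trans x m n : (m <= n)%N -> enat_le x (Some m) -> enat_le x (Some n).
Proof. by case: x => //= k mn km; exact: leq_trans km mn. Qed.

(** Asking for some length [k <= n] avoids padding a resolution to length exactly [n]. *)
Lemma Gfd_le (R : comNzRingType) (M : lmodType R) n :
  enat_le (Gfd M) (Some n) <-> exists2 k, (k <= n)%N & gflat_resolution M k.
Proof.
rewrite /Gfd /least; case: pselect => [exP|nP] /=.
  case: ex_minnP => m /asboolP rm mmin; split=> [mn|[k kn rk]]; first by exists m.
  by apply: leq_trans kn; exact/mmin/asboolP.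
by split=> // -[k _ rk]; apply: nP; exists k; apply/asboolP.
Qed.

Lemma Gwdim_le (R : comNzRingType) n :
  enat_le (Gwdim R) (Some n) <-> injectives_fd_le R n.
Proof.
rewrite -gflat_resolutions_le /Gwdim /enat_sup least_le.
  by split=> h M; exact/Gfd_le/h.
by move=> i j ij h M; exact: enat_le_trans ij (h M).
Qed.

Theorem theorem2p11 (R : comNzRingType) (coherent_RX : coherent {poly R}) :
  Gwdim {poly R} = enat_succ (Gwdim R).
Proof.
apply: enat_eq => n; rewrite Gwdim_le.
(* The bound 0 is treated apart: no successor meets it, and neither does [Gwdim {poly R}]. *)
case: n => [|n].
  by split=> [/injectives_not_flat_poly|] //; case: (Gwdim R).
have -> : enat_le (enat_succ (Gwdim R)) (Some n.+1) = enat_le (Gwdim R) (Some n).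
  by case: (Gwdim R).
rewrite Gwdim_le.
by split; [exact: injectives_fd_le_of_poly | exact: injectives_fd_le_poly].
Qed.
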